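(* Over $\mathsf{RCA}_0$, $\mathsf{RP}$ implies $\mathsf{WKL}$. That is, $\mathsf{RCA}_0$ together with the principle ''every topological dynamical system $(C,f)$ on $2^\omega$ contains a recurrent point'' proves weak König's lemma ($\mathsf{WKL}$: every infinite subtree of $2^{<\omega}$ has an infinite path).
   Context: Work in second order arithmetic; $\omega$ denotes the natural numbers of the model. $2^{<\omega}$ is the set of finite binary strings, $\lambda$ the empty string, $|\sigma|$ the length of $\sigma$, $\preceq$ the initial segment relation (also between a string and an infinite sequence), and $X\upharpoonright_n$ the initial segment of $X$ of length $n$. A tree is a subset of $2^{<\omega}$ closed under initial segments; $[C]$ denotes the collection of infinite paths through a tree $C$. A function $f:2^{<\omega}\to 2^{<\omega}$ encodes a continuous transformation of $2^\omega$ if (1) $f$ is total; (2) $f$ is order preserving, i.e. $\sigma\preceq\tau$ implies $f(\sigma)\preceq f(\tau)$; (3) $(\forall l)(\exists m)(\forall\sigma\in\{0,1\}^m)\,|f(\sigma)|\ge l$. By convention such an $f$ is also assumed to satisfy $|f(\sigma)|<|\sigma|$ for all $\sigma\ne\lambda$. The transformation encoded is $F(X)=\lim_l f(X\upharpoonright_l)$. Put $f^0(\sigma)=\sigma$, $f^k(\sigma)=f(f^{k-1}(\sigma))$ for $k>0$, and $F^k(X)=\lim_l f^k(X\upharpoonright_l)$. A pair $(C,f)$ is a (topological dynamical) system on $2^\omega$ if (i) $C$ is a tree; (ii) $f$ encodes a continuous transformation of $2^\omega$; (iii) $[C]\neq\emptyset$; (iv) for all $\sigma\in C$, $f(\sigma)\in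 C$. $X$ is a recurrent point of $(C,f)$ if $X\in[C]$ and $(\forall n,c)(\exists k)\,(F^{n+k}(X)\succeq X\upharpoonright_c)$. $\mathsf{RP}$ is the principle that every system on $2^\omega$ contains a recurrent point. *)

(* Defs.v *)
(* The two-sorted language L2 of second order arithmetic, classical natural
   deduction for it, the theory RCA0, and the L2-sentences RP and WKL. *)
From Stdlib Require Import List.
Import ListNotations.

(* ** Syntax *)

(* De Bruijn indices; number variables and set variables are indexed
   separately, so [All]/[Ex] bind number variable 0 and [AllS]/[ExS] bind set
   variable 0. *)
Inductive term : Type :=
| Var (n : nat)
| Zero
| One
| Add (t u : term)
| Mul (t u : term).

Inductive formula : Type :=
| Eq (t u : term)
| Lt (t u : term)
| Mem (t : term) (X : nat)
| Bot
| Imp (p q : formula)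
| And (p q : formula)
| Or (p q : formula)
| All (p : formula)
| Ex (p : formula)
| AllS (p : formula)
| ExS (p : formula).

Definition Neg (p : formula) : formula := Imp p Bot.
Definition Iff (p q : formula) : formula := And (Imp p q) (Imp q p).

Fixpoint tsubst (s : nat -> term) (t : term) : term :=
  match t with
  | Var n => s n
  | Zero => Zero
  | One => One
  | Add t u => Add (tsubst s t) (tsubst s u)
  | Mul t u => Mul (tsubst s t) (tsubst s u)
  end.

Definition scons {A : Type} (a : A) (s : nat -> A) (n : nat) : A :=
  match n with 0 => a | S m => s m end.

Definition tshift : term -> term := tsubst (fun n => Var (S n)).
Definition up (s : nat -> term) : nat -> term :=
  scons (Var 0) (fun n => tshift (s n)).
Definition upS (r : nat -> nat) : nat -> nat := scons 0 (fun n => S (r n)).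

Fixpoint fsubst (s : nat -> term) (r : nat -> nat) (p : formula) : formula :=
  match p with
  | Eq t u => Eq (tsubst s t) (tsubst s u)
  | Lt t u => Lt (tsubst s t) (tsubst s u)
  | Mem t X => Mem (tsubst s t) (r X)
  | Bot => Bot
  | Imp p q => Imp (fsubst s r p) (fsubst s r q)
  | And p q => And (fsubst s r p) (fsubst s r q)
  | Or p q => Or (fsubst s r p) (fsubst s r q)
  | All p => All (fsubst (up s) r p)
  | Ex p => Ex (fsubst (up s) r p)
  | AllS p => AllS (fsubst s (upS r) p)
  | ExS p => ExS (fsubst s (upS r) p)
  end.

Definition shift : formula -> formula :=
  fsubst (fun n => Var (S n)) (fun X => X).
Definition shiftS : formula -> formula := fsubst Var S.
Definition inst (t : term) : formula -> formula :=
  fsubst (scons t Var) (fun X => X).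
Definition instS (X : nat) : formula -> formula :=
  fsubst Var (scons X (fun Y => Y)).

(* ** Derivability *)

(* [prv T G p]: [p] is derivable from the axioms [T] and the open assumptions
   [G].  The quantifier rules shift [G] but not [T]: free variables of an
   axiom are read as universally quantified. *)
Inductive prv (T : formula -> Prop) : list formula -> formula -> Prop :=
| prv_ax G p : T p -> prv T G p
| prv_hyp G p : In p G -> prv T G p
| prv_raa G p : prv T (Neg p :: G) Bot -> prv T G p
| prv_impI G p q : prv T (p :: G) q -> prv T G (Imp p q)
| prv_impE G p q : prv T G (Imp p q) -> prv T G p -> prv T G q
| prv_andI G p q : prv T G p -> prv T G q -> prv T G (And p q)
| prv_andE1 G p q : prv T G (And p q) -> prv T G p
| prv_andE2 G p q : prv T G (And p q) -> prv T G q
| prv_orI1 G p q : prv T G p -> prv T G (Or p q)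
| prv_orI2 G p q : prv T G q -> prv T G (Or p q)
| prv_orE G p q r :
    prv T G (Or p q) -> prv T (p :: G) r -> prv T (q :: G) r -> prv T G r
| prv_allI G p : prv T (map shift G) p -> prv T G (All p)
| prv_allE G p t : prv T G (All p) -> prv T G (inst t p)
| prv_exI G p t : prv T G (inst t p) -> prv T G (Ex p)
| prv_exE G p q :
    prv T G (Ex p) -> prv T (p :: map shift G) (shift q) -> prv T G q
| prv_allSI G p : prv T (map shiftS G) p -> prv T G (AllS p)
| prv_allSE G p X : prv T G (AllS p) -> prv T G (instS X p)
| prv_exSI G p X : prv T G (instS X p) -> prv T G (ExS p)
| prv_exSE G p q :
    prv T G (ExS p) -> prv T (p :: map shiftS G) (shiftS q) -> prv T G q
| prv_eqI G t : prv T G (Eq t t)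
| prv_eqE G p t u :
    prv T G (Eq t u) -> prv T G (inst t p) -> prv T G (inst u p).

Definition proves (T : formula -> Prop) (p : formula) : Prop := prv T [] p.

Definition extend (T : formula -> Prop) (p : formula) : formula -> Prop :=
  fun q => T q \/ q = p.

(* ** Named binders *)

(* A [pform] is a formula awaiting the number of number binders and of set
   binders above it; a bound variable is a function of the depth at which it
   occurs.  Sentences can so be written with Rocq binders; [close] computes
   the de Bruijn formula. *)
Definition pterm : Type := nat -> term.
Definition pset : Type := nat -> nat.
Definition pform : Type := nat -> nat -> formula.

Definition close (p : pform) : formula := p 0 0.

Definition pzero : pterm := fun _ => Zero.
Definition pone : pterm := fun _ => One.
Definition padd (t u : pterm) : pterm := fun d => Add (t d) (u d).
Definition pmul (t u : pterm) : pterm := fun d => Mul (t d) (u d).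

Definition peq (t u : pterm) : pform := fun d _ => Eq (t d) (u d).
Definition plt (t u : pterm) : pform := fun d _ => Lt (t d) (u d).
Definition pmem (t : pterm) (X : pset) : pform := fun d e => Mem (t d) (X e).
Definition pneg (p : pform) : pform := fun d e => Neg (p d e).
Definition pimp (p q : pform) : pform := fun d e => Imp (p d e) (q d e).
Definition piff (p q : pform) : pform := fun d e => Iff (p d e) (q d e).
Definition pand (p q : pform) : pform := fun d e => And (p d e) (q d e).
Definition por (p q : pform) : pform := fun d e => Or (p d e) (q d e).
Definition pall (F : pterm -> pform) : pform :=
  fun d e => All (F (fun d' => Var (d' - S d)) (S d) e).
Definition pex (F : pterm -> pform) : pform :=
  fun d e => Ex (F (fun d' => Var (d' - S d)) (S d) e).
Definition pallS (F : pset -> pform) : pform :=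
  fun d e => AllS (F (fun e' => e' - S e) d (S e)).
Definition pexS (F : pset -> pform) : pform :=
  fun d e => ExS (F (fun e' => e' - S e) d (S e)).

Declare Scope L2_scope.
Delimit Scope L2_scope with L2.
Bind Scope L2_scope with pterm pset pform.

Notation "0" := pzero : L2_scope.
Notation "1" := pone : L2_scope.
Notation "t + u" := (padd t u) : L2_scope.
Notation "t * u" := (pmul t u) : L2_scope.
Notation "t = u" := (peq t u) : L2_scope.
Notation "t < u" := (plt t u) : L2_scope.
Notation "t <= u" := (plt t (padd u pone)) : L2_scope.
Notation "t ∈ X" := (pmem t X) (at level 70) : L2_scope.
Notation "¬ p" := (pneg p) (at level 75, right associativity) : L2_scope.
Notation "p ∧ q" := (pand p q) (at level 80, right associativity) : L2_scope.
Notation "p ∨ q" := (por p q) (at level 85, right associativity) : L2_scope.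
Notation "p ⟶ q" := (pimp p q) (at level 99, q at level 200) : L2_scope.
Notation "p ⟷ q" := (piff p q) (at level 95, no associativity) : L2_scope.
Notation "'∀' x , p" := (pall (fun x => p))
  (at level 200, x name, p at level 200) : L2_scope.
Notation "'∃' x , p" := (pex (fun x => p))
  (at level 200, x name, p at level 200) : L2_scope.
Notation "'∀' x '≺' t , p" := (pall (fun x => pimp (plt x t) p))
  (at level 200, x name, t at level 69, p at level 200) : L2_scope.
Notation "'∃' x '≺' t , p" := (pex (fun x => pand (plt x t) p))
  (at level 200, x name, t at level 69, p at level 200) : L2_scope.
Notation "'∀²' X , p" := (pallS (fun X => p))
  (at level 200, X name, p at level 200) : L2_scope.
Notation "'∃²' X , p" := (pexS (fun X => p))
  (at level 200, X name, p at level 200) : L2_scope.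

Local Open Scope L2_scope.

(* ** RCA0 *)

Inductive basic_axiom : formula -> Prop :=
| succ_neq0 : basic_axiom (close (∀ n, ¬ (n + 1 = 0)))
| succ_inj : basic_axiom (close (∀ m, ∀ n, m + 1 = n + 1 ⟶ m = n))
| add_0 : basic_axiom (close (∀ m, m + 0 = m))
| add_succ : basic_axiom (close (∀ m, ∀ n, m + (n + 1) = (m + n) + 1))
| mul_0 : basic_axiom (close (∀ m, m * 0 = 0))
| mul_succ : basic_axiom (close (∀ m, ∀ n, m * (n + 1) = (m * n) + m))
| lt_0 : basic_axiom (close (∀ m, ¬ (m < 0)))
| lt_succ :
    basic_axiom (close (∀ m, ∀ n, m < n + 1 ⟷ (m < n ∨ m = n))).

Inductive Delta00 : formula -> Prop :=
| D_eq t u : Delta00 (Eq t u)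
| D_lt t u : Delta00 (Lt t u)
| D_mem t X : Delta00 (Mem t X)
| D_bot : Delta00 Bot
| D_imp p q : Delta00 p -> Delta00 q -> Delta00 (Imp p q)
| D_and p q : Delta00 p -> Delta00 q -> Delta00 (And p q)
| D_or p q : Delta00 p -> Delta00 q -> Delta00 (Or p q)
| D_ball t p : Delta00 p -> Delta00 (All (Imp (Lt (Var 0) (tshift t)) p))
| D_bex t p : Delta00 p -> Delta00 (Ex (And (Lt (Var 0) (tshift t)) p)).

Inductive Sigma01 : formula -> Prop :=
| Sigma01_ex p : Delta00 p -> Sigma01 (Ex p).
Inductive Pi01 : formula -> Prop :=
| Pi01_all p : Delta00 p -> Pi01 (All p).

(* In both schemes number variable 0 is the distinguished one; all other free
   variables are parameters. *)
Definition induction (p : formula) : formula :=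
  Imp (And (inst Zero p)
           (All (Imp p (fsubst (scons (Add (Var 0) One) (fun n => Var (S n)))
                               (fun X => X) p))))
      (All p).

Definition comprehension (p q : formula) : formula :=
  Imp (All (Iff p q)) (ExS (All (Iff (Mem (Var 0) 0) (shiftS p)))).

Inductive RCA0 : formula -> Prop :=
| ax_basic p : basic_axiom p -> RCA0 p
| ax_induction p : Sigma01 p -> RCA0 (induction p)
| ax_comprehension p q : Sigma01 p -> Pi01 q -> RCA0 (comprehension p q).

(* ** Finite sequences *)

Definition pair (x y : pterm) : pterm := (x + y) * (x + y) + x.

(* The number (l, (a, b)) represents the sequence of length l whose i-th entry
   is the remainder of a modulo b(i+1)+1 (Gödel's beta function).  Every finite
   sequence is so represented, but not uniquely: its code is the least
   representation. *)
Definition Len (s l : pterm) : pform :=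
  ∃ a ≺ s + 1, ∃ b ≺ s + 1, s = pair l (pair a b).

Definition Entry (s i v : pterm) : pform :=
  ∃ l ≺ s + 1, ∃ a ≺ s + 1, ∃ b ≺ s + 1,
    s = pair l (pair a b) ∧ i < l ∧ v < b * (i + 1) + 1 ∧
    ∃ q ≺ a + 1, a = q * (b * (i + 1) + 1) + v.

Definition SameSeq (s t : pterm) : pform :=
  ∃ l ≺ s + 1, Len s l ∧ Len t l ∧
    ∀ i ≺ l, ∃ v ≺ s + 1, Entry s i v ∧ Entry t i v.

Definition Seq (s : pterm) : pform :=
  (∃ l ≺ s + 1, Len s l) ∧ ∀ t ≺ s, ¬ SameSeq s t.

(* σ ∈ 2^{<ω} *)
Definition Str (σ : pterm) : pform :=
  Seq σ ∧ ∀ i ≺ σ + 1, ∀ v ≺ σ + 1, Entry σ i v ⟶ (v = 0 ∨ v = 1).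

(* σ ⪯ τ *)
Definition Prefix (σ τ : pterm) : pform :=
  ∃ k ≺ σ + 1, ∃ l ≺ τ + 1, Len σ k ∧ Len τ l ∧ k <= l ∧
    ∀ i ≺ k, ∃ v ≺ σ + 1, Entry σ i v ∧ Entry τ i v.

(* σ = X↾n; a set X is identified with its characteristic function, a point
   of 2^ω. *)
Definition Restr (X : pset) (n σ : pterm) : pform :=
  Str σ ∧ Len σ n ∧ ∀ i ≺ n, Entry σ i 1 ⟷ i ∈ X.

(* ** Trees and weak König's lemma *)

Definition Tree (C : pset) : pform :=
  (∀ σ, σ ∈ C ⟶ Str σ) ∧
  (∀ σ, ∀ τ, Str σ ∧ τ ∈ C ∧ Prefix σ τ ⟶ σ ∈ C).

(* X ∈ [C] *)
Definition Path (C X : pset) : pform :=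
  ∀ n, ∃ σ, Restr X n σ ∧ σ ∈ C.

Definition Infinite (X : pset) : pform := ∀ m, ∃ n, m < n ∧ n ∈ X.

Definition WKL : formula :=
  close (∀² T, Tree T ∧ Infinite T ⟶ ∃² X, Path T X).

(* ** Systems and recurrent points *)

(* f(σ) = τ; a function is the set of pairs forming its graph. *)
Definition App (f : pset) (σ τ : pterm) : pform := pair σ τ ∈ f.

(* f : 2^{<ω} → 2^{<ω} *)
Definition StrFun (f : pset) : pform :=
  (∀ z, z ∈ f ⟶ ∃ σ, ∃ τ, z = pair σ τ ∧ Str σ ∧ Str τ) ∧
  (∀ σ, Str σ ⟶ ∃ τ, App f σ τ ∧ ∀ ρ, App f σ ρ ⟶ ρ = τ).

(* The last clause is |f(σ)| < |σ| for σ ≠ λ. *)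
Definition EncodesTransformation (f : pset) : pform :=
  StrFun f ∧
  (∀ σ, ∀ τ, ∀ σ', ∀ τ',
     Str σ ∧ Str τ ∧ Prefix σ τ ∧ App f σ σ' ∧ App f τ τ' ⟶ Prefix σ' τ') ∧
  (∀ l, ∃ m, ∀ σ, Str σ ∧ Len σ m ⟶
     ∃ τ, ∃ k, App f σ τ ∧ Len τ k ∧ l <= k) ∧
  (∀ σ, ∀ τ, ∀ m, ∀ k,
     Str σ ∧ Len σ m ∧ ¬ (m = 0) ∧ App f σ τ ∧ Len τ k ⟶ k < m).

(* f^k(σ) = τ, witnessed by the sequence σ, f(σ), ..., f^k(σ). *)
Definition Iter (f : pset) (k σ τ : pterm) : pform :=
  ∃ s, Seq s ∧ Len s (k + 1) ∧ Entry s 0 σ ∧ Entry s k τ ∧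
    ∀ i ≺ k, ∃ u, ∃ v, Entry s i u ∧ Entry s (i + 1) v ∧ App f u v.

(* Y = F^k(X) = lim_l f^k(X↾l) *)
Definition IterPoint (f : pset) (k : pterm) (X Y : pset) : pform :=
  ∀ n, ∃ ρ, Restr Y n ρ ∧
    ∃ m, ∀ l, m <= l ⟶
      ∃ σ, ∃ τ, Restr X l σ ∧ Iter f k σ τ ∧ Prefix ρ τ.

Definition System (C f : pset) : pform :=
  Tree C ∧ EncodesTransformation f ∧ (∃² X, Path C X) ∧
  (∀ σ, ∀ τ, σ ∈ C ∧ App f σ τ ⟶ τ ∈ C).

(* The matrix of the second conjunct is F^{n+k}(X) ⪰ X↾c. *)
Definition RecurrentPoint (C f X : pset) : pform :=
  Path C X ∧
  (∀ n, ∀ c, ∃ k, ∃² Y, IterPoint f (n + k) X Y ∧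
     ∃ ρ, Restr X c ρ ∧ Restr Y c ρ).

Definition RP : formula :=
  close (∀² C, ∀² f, System C f ⟶ ∃² X, RecurrentPoint C f X).

(* Main.v *)
From Stdlib Require Import List Arith Lia Ring Cantor.
From Stdlib Require Import Classical ClassicalEpsilon FunctionalExtensionality
  PropExtensionality ProofIrrelevance.
Require Import Defs.
Import ListNotations.

(** A derivation is obtained from its semantic counterpart: [completeness]
    reduces the theorem to showing that every structure in which [RCA0] and [RP]
    are true satisfies [WKL].  Inside such a structure, whose numbers may be
    nonstandard, the argument runs as follows.

    Let [T] be an infinite tree.  Points of Cantor space are read as sequences
    of symbols, two bits each: a flag, which when set makes the symbol a
    separator, and a datum.  Let [F] delete the symbol just before the first
    separator, or the separator itself when it is the very first symbol, and fix
    the points without separators.  The first block of symbols is thus eaten up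
    from its end, then its separator disappears, and the next block is eaten up.
    Whether the symbol [j] of the image is the symbol [j] or the symbol [j + 1]
    of the argument depends only on the separators up to [j + 1], so [F] is
    encoded by a map on strings that drops two bits ([step]).  Let [C] consist
    of the strings whose blocks all spell members of [T] and in which, of any two
    adjacent blocks closed by separators on both sides, the second is longer
    ([admissible]); it is a tree that the map preserves ([admissible_step]).  It
    has a path: put the separators at the squares and fill the gaps with strings
    of [T] of the right lengths ([admissible_path]).

    Now take a recurrent point of this system.  Suppose it had two separators,
    the first at [a] and the second at [a + d].  One application of the map
    either keeps [d] and lowers [a], or lets the next block take over and
    raises [d] ([state_step]).  Hence no later iterate agrees with the point up
    to its second separator ([iter_not_recurrent]).  So a recurrent point has at
    most one separator, and the infinite block that remains is a path through
    [T] ([path_of_tail]).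

    What this takes from arithmetic is small.  Strings are coded through
    remainders, so there must be a string with any prescribed bits ([beta],
    [restriction_exists]); and there must be strings of every length in an
    infinite tree, which holds because the codes of the strings of bounded length
    are bounded ([strings_bounded]).  General sequences occur only in the
    hypothesis that iterates exist and are never constructed. *)

Arguments tshift : simpl never.

(** * Structures and satisfaction *)

(** Equality of terms will be interpreted by identity; [some_set] guarantees that
    set variables can be assigned a value. *)
Record structure : Type := {
  num : Type;
  set : Type;
  zero : num;
  one : num;
  add : num -> num -> num;
  mul : num -> num -> num;
  lt : num -> num -> Prop;
  mem : num -> set -> Prop;
  some_set : set
}.

Arguments zero {s}.
Arguments one {s}.
Arguments add {s} _ _.
Arguments mul {s} _ _.
Arguments lt {s} _ _.
Arguments mem {s} _ _.

Fixpoint eval (M : structure) (e : nat -> num M) (t : term) : num M :=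
  match t with
  | Var n => e n
  | Zero => zero
  | One => one
  | Add t u => add (eval M e t) (eval M e u)
  | Mul t u => mul (eval M e t) (eval M e u)
  end.

Fixpoint sat (M : structure) (e : nat -> num M) (r : nat -> set M)
    (p : formula) : Prop :=
  match p with
  | Eq t u => eval M e t = eval M e u
  | Lt t u => lt (eval M e t) (eval M e u)
  | Mem t X => mem (eval M e t) (r X)
  | Bot => False
  | Imp p q => sat M e r p -> sat M e r q
  | And p q => sat M e r p /\ sat M e r q
  | Or p q => sat M e r p \/ sat M e r q
  | All p => forall x, sat M (scons x e) r p
  | Ex p => exists x, sat M (scons x e) r p
  | AllS p => forall X, sat M e (scons X r) p
  | ExS p => exists X, sat M e (scons X r) p
  end.

Lemma eval_ext M e e' t : (forall n, e n = e' n) -> eval M e t = eval M e' t.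
Proof. intros E; induction t; simpl; congruence. Qed.

Lemma scons_ext {A} (x : A) e e' :
  (forall n, e n = e' n) -> forall n, scons x e n = scons x e' n.
Proof. intros E [|n]; simpl; auto. Qed.

Lemma sat_ext M p : forall e e' r r',
  (forall n, e n = e' n) -> (forall X, r X = r' X) ->
  (sat M e r p <-> sat M e' r' p).
Proof.
  induction p; simpl; intros e e' r r' Ee Er;
    rewrite ?(eval_ext M e e'), ?Er; auto; try reflexivity.
  - now rewrite (IHp1 e e' r r'), (IHp2 e e' r r').
  - now rewrite (IHp1 e e' r r'), (IHp2 e e' r r').
  - now rewrite (IHp1 e e' r r'), (IHp2 e e' r r').
  - assert (E : forall x, sat M (scons x e) r p <-> sat M (scons x e') r' p)
      by (intros; apply IHp; auto using scons_ext).
    split; intros H x; apply E; auto.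
  - assert (E : forall x, sat M (scons x e) r p <-> sat M (scons x e') r' p)
      by (intros; apply IHp; auto using scons_ext).
    split; intros [x H]; exists x; apply E; auto.
  - assert (E : forall X, sat M e (scons X r) p <-> sat M e' (scons X r') p)
      by (intros; apply IHp; auto using scons_ext).
    split; intros H X; apply E; auto.
  - assert (E : forall X, sat M e (scons X r) p <-> sat M e' (scons X r') p)
      by (intros; apply IHp; auto using scons_ext).
    split; intros [X H]; exists X; apply E; auto.
Qed.

Lemma eval_tsubst M e s t :
  eval M e (tsubst s t) = eval M (fun n => eval M e (s n)) t.
Proof. induction t; simpl; congruence. Qed.

Lemma sat_fsubst M p : forall e r s rho,
  sat M e r (fsubst s rho p) <->
  sat M (fun n => eval M e (s n)) (fun X => r (rho X)) p.
Proof.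
  induction p; simpl; intros e r s rho; rewrite ?eval_tsubst; try reflexivity.
  - now rewrite IHp1, IHp2.
  - now rewrite IHp1, IHp2.
  - now rewrite IHp1, IHp2.
  - split; intros H x; specialize (H x); rewrite IHp in *;
      revert H; apply sat_ext; auto; intros [|n]; simpl; auto;
      unfold tshift; now rewrite eval_tsubst.
  - split; intros [x H]; exists x; rewrite IHp in *;
      revert H; apply sat_ext; auto; intros [|n]; simpl; auto;
      unfold tshift; now rewrite eval_tsubst.
  - split; intros H X; specialize (H X); rewrite IHp in *;
      revert H; apply sat_ext; auto; now intros [|Y].
  - split; intros [X H]; exists X; rewrite IHp in *;
      revert H; apply sat_ext; auto; now intros [|Y].
Qed.

(** * Substitution *)

Lemma tsubst_ext s s' t :
  (forall n, s n = s' n) -> tsubst s t = tsubst s' t.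
Proof. intros E; induction t; simpl; congruence. Qed.

Lemma tsubst_comp s1 s2 t :
  tsubst s2 (tsubst s1 t) = tsubst (fun n => tsubst s2 (s1 n)) t.
Proof. induction t; simpl; congruence. Qed.

Lemma tsubst_id t : tsubst Var t = t.
Proof. induction t; simpl; congruence. Qed.

Lemma up_ext s s' : (forall n, s n = s' n) -> forall n, up s n = up s' n.
Proof. intros E [|n]; simpl; [reflexivity | now rewrite E]. Qed.

Lemma upS_ext r r' : (forall n, r n = r' n) -> forall n, upS r n = upS r' n.
Proof. intros E [|n]; simpl; [reflexivity | now rewrite E]. Qed.

Lemma fsubst_ext p : forall s s' r r',
  (forall n, s n = s' n) -> (forall X, r X = r' X) ->
  fsubst s r p = fsubst s' r' p.
Proof.
  induction p; simpl; intros s s' r r' Es Er; f_equal; auto using tsubst_ext.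
  - apply IHp; auto using up_ext.
  - apply IHp; auto using up_ext.
  - apply IHp; auto using upS_ext.
  - apply IHp; auto using upS_ext.
Qed.

Lemma tsubst_up_shift s t : tsubst (up s) (tshift t) = tshift (tsubst s t).
Proof. unfold tshift; rewrite !tsubst_comp; now apply tsubst_ext. Qed.

Lemma up_comp s1 s2 n :
  tsubst (up s2) (up s1 n) = up (fun m => tsubst s2 (s1 m)) n.
Proof. destruct n; simpl; [reflexivity | apply tsubst_up_shift]. Qed.

Lemma fsubst_comp p : forall s1 r1 s2 r2,
  fsubst s2 r2 (fsubst s1 r1 p) =
  fsubst (fun n => tsubst s2 (s1 n)) (fun X => r2 (r1 X)) p.
Proof.
  induction p; simpl; intros s1 r1 s2 r2; f_equal; auto using tsubst_comp.
  - rewrite IHp; apply fsubst_ext; auto using up_comp.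
  - rewrite IHp; apply fsubst_ext; auto using up_comp.
  - rewrite IHp; apply fsubst_ext; [auto | now intros [|X]].
  - rewrite IHp; apply fsubst_ext; [auto | now intros [|X]].
Qed.

Lemma fsubst_id p : fsubst Var (fun X => X) p = p.
Proof.
  assert (G : forall s r, (forall n, s n = Var n) -> (forall X, r X = X) ->
                     fsubst s r p = p); [|now apply G].
  assert (Gt : forall s t, (forall n, s n = Var n) -> tsubst s t = t).
  { intros s t E; rewrite <- (tsubst_id t) at 2; now apply tsubst_ext. }
  induction p; simpl; intros s r Es Er; f_equal; auto.
  - apply IHp; auto; intros [|n]; simpl; [|rewrite Es]; auto.
  - apply IHp; auto; intros [|n]; simpl; [|rewrite Es]; auto.
  - apply IHp; auto; intros [|n]; simpl; auto.
  - apply IHp; auto; intros [|n]; simpl; auto.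
Qed.

Lemma fsubst_shift s r p : fsubst (up s) r (shift p) = shift (fsubst s r p).
Proof. unfold shift; rewrite !fsubst_comp; now apply fsubst_ext. Qed.

Lemma fsubst_shiftS s r p :
  fsubst s (upS r) (shiftS p) = shiftS (fsubst s r p).
Proof.
  unfold shiftS; rewrite !fsubst_comp; apply fsubst_ext; auto.
  intros n; simpl; symmetry; apply tsubst_id.
Qed.

Lemma fsubst_inst s r t p :
  fsubst s r (inst t p) = inst (tsubst s t) (fsubst (up s) r p).
Proof.
  unfold inst; rewrite !fsubst_comp; apply fsubst_ext; auto.
  intros [|n]; simpl; auto; unfold tshift; rewrite tsubst_comp; simpl.
  symmetry; apply tsubst_id.
Qed.

Lemma fsubst_instS s r X p :
  fsubst s r (instS X p) = instS (r X) (fsubst s (upS r) p).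
Proof.
  unfold instS; rewrite !fsubst_comp; apply fsubst_ext.
  - intros n; simpl; symmetry; apply tsubst_id.
  - now intros [|Y].
Qed.

Lemma inst_up s r t p : inst t (fsubst (up s) r p) = fsubst (scons t s) r p.
Proof.
  unfold inst; rewrite fsubst_comp; apply fsubst_ext; auto.
  intros [|n]; simpl; auto; unfold tshift; rewrite tsubst_comp; apply tsubst_id.
Qed.

Lemma instS_up s r X p :
  instS X (fsubst s (upS r) p) = fsubst s (scons X r) p.
Proof.
  unfold instS; rewrite fsubst_comp; apply fsubst_ext.
  - intros n; apply tsubst_id.
  - now intros [|Y].
Qed.

(** * Derivations under weakening and substitution *)

Lemma prv_weak T G p : prv T G p -> forall G', incl G G' -> prv T G' p.
Proof.
  induction 1; intros G' I.
  - now apply prv_ax.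
  - apply prv_hyp; auto.
  - apply prv_raa, IHprv; intros x [<-|Hx]; simpl; auto.
  - apply prv_impI, IHprv; intros x [<-|Hx]; simpl; auto.
  - eapply prv_impE; eauto.
  - apply prv_andI; auto.
  - eapply prv_andE1; eauto.
  - eapply prv_andE2; eauto.
  - apply prv_orI1; auto.
  - apply prv_orI2; auto.
  - eapply prv_orE; [apply IHprv1; auto | apply IHprv2 | apply IHprv3];
      intros x [<-|Hx]; simpl; auto.
  - apply prv_allI, IHprv, incl_map; auto.
  - eapply prv_allE; eauto.
  - eapply prv_exI; eauto.
  - eapply prv_exE; [apply IHprv1; auto | apply IHprv2].
    intros x [<-|Hx]; [now left | right; eapply incl_map; eauto].
  - apply prv_allSI, IHprv, incl_map; auto.
  - eapply prv_allSE; eauto.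
  - eapply prv_exSI; eauto.
  - eapply prv_exSE; [apply IHprv1; auto | apply IHprv2].
    intros x [<-|Hx]; [now left | right; eapply incl_map; eauto].
  - apply prv_eqI.
  - eapply prv_eqE; eauto.
Qed.

Section Completeness.

Variable T : formula -> Prop.
Hypothesis T_subst : forall s r p, T p -> T (fsubst s r p).

Lemma map_fsubst_shift s r G :
  map (fsubst (up s) r) (map shift G) = map shift (map (fsubst s r) G).
Proof.
  rewrite !map_map; apply map_ext; intros; apply fsubst_shift.
Qed.

Lemma map_fsubst_shiftS s r G :
  map (fsubst s (upS r)) (map shiftS G) = map shiftS (map (fsubst s r) G).
Proof.
  rewrite !map_map; apply map_ext; intros; apply fsubst_shiftS.
Qed.

(** The axioms are not shifted under quantifiers, so derivability is stable under
    substitution only because the set of axioms is. *)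
Lemma prv_subst G p : prv T G p ->
  forall s r, prv T (map (fsubst s r) G) (fsubst s r p).
Proof.
  induction 1; intros s0 r0; simpl in *.
  - apply prv_ax; auto.
  - apply prv_hyp, in_map; auto.
  - apply prv_raa, (IHprv s0 r0).
  - apply prv_impI, IHprv.
  - eapply prv_impE; [apply IHprv1 | apply IHprv2].
  - apply prv_andI; auto.
  - eapply prv_andE1, IHprv.
  - eapply prv_andE2, IHprv.
  - apply prv_orI1; auto.
  - apply prv_orI2; auto.
  - eapply prv_orE; [apply IHprv1 | apply IHprv2 | apply IHprv3].
  - apply prv_allI; rewrite <- map_fsubst_shift; apply IHprv.
  - rewrite fsubst_inst; apply prv_allE, IHprv.
  - eapply prv_exI; rewrite <- fsubst_inst; apply IHprv.
  - eapply prv_exE; [apply IHprv1 |].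
    rewrite <- map_fsubst_shift, <- fsubst_shift; apply IHprv2.
  - apply prv_allSI; rewrite <- map_fsubst_shiftS; apply IHprv.
  - rewrite fsubst_instS; apply prv_allSE, IHprv.
  - eapply prv_exSI; rewrite <- fsubst_instS; apply IHprv.
  - eapply prv_exSE; [apply IHprv1 |].
    rewrite <- map_fsubst_shiftS, <- fsubst_shiftS; apply IHprv2.
  - apply prv_eqI.
  - rewrite fsubst_inst; eapply prv_eqE; [apply IHprv1 |].
    rewrite <- fsubst_inst; apply IHprv2.
Qed.

(** * Free variables *)

Fixpoint tbound (t : term) : nat :=
  match t with
  | Var n => S n
  | Zero | One => 0
  | Add t u | Mul t u => Nat.max (tbound t) (tbound u)
  end.

Fixpoint nbound (p : formula) : nat :=
  match p with
  | Eq t u | Lt t u => Nat.max (tbound t) (tbound u)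
  | Mem t _ => tbound t
  | Bot => 0
  | Imp p q | And p q | Or p q => Nat.max (nbound p) (nbound q)
  | All p | Ex p => Nat.pred (nbound p)
  | AllS p | ExS p => nbound p
  end.

Fixpoint sbound (p : formula) : nat :=
  match p with
  | Eq _ _ | Lt _ _ | Bot => 0
  | Mem _ X => S X
  | Imp p q | And p q | Or p q => Nat.max (sbound p) (sbound q)
  | All p | Ex p => sbound p
  | AllS p | ExS p => Nat.pred (sbound p)
  end.

Lemma tsubst_agree s s' t :
  (forall n, n < tbound t -> s n = s' n) -> tsubst s t = tsubst s' t.
Proof.
  induction t; simpl; intros E; auto;
    rewrite IHt1, IHt2; auto; intros; apply E; lia.
Qed.

Lemma fsubst_agree p : forall s s' r r',
  (forall n, n < nbound p -> s n = s' n) ->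
  (forall X, X < sbound p -> r X = r' X) ->
  fsubst s r p = fsubst s' r' p.
Proof.
  assert (ET : forall t s s', (forall n, n < tbound t -> s n = s' n) ->
                         tsubst s t = tsubst s' t) by auto using tsubst_agree.
  induction p; simpl; intros s s' r r' Es Er; auto;
    try (f_equal; first [apply ET | apply Er | apply IHp1 | apply IHp2];
         intros; first [apply Es | apply Er | idtac]; lia);
    f_equal; apply IHp; auto; intros [|n] Hn; simpl; auto.
  - rewrite Es; auto; lia.
  - rewrite Es; auto; lia.
  - rewrite Er; auto; lia.
  - rewrite Er; auto; lia.
Qed.

Fixpoint nfresh (G : list formula) : nat :=
  match G with [] => 0 | p :: G => Nat.max (nbound p) (nfresh G) end.
Fixpoint sfresh (G : list formula) : nat :=
  match G with [] => 0 | p :: G => Nat.max (sbound p) (sfresh G) end.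

Lemma nfresh_in p G : In p G -> nbound p <= nfresh G.
Proof. induction G; simpl; intros []; subst; [lia | apply IHG in H; lia]. Qed.
Lemma sfresh_in p G : In p G -> sbound p <= sfresh G.
Proof. induction G; simpl; intros []; subst; [lia | apply IHG in H; lia]. Qed.

(** * Maximal consistent Henkin theories *)

Definition consistent (G : list formula) : Prop := ~ prv T G Bot.

(** Renaming the fresh variable to the eigenvariable of the elimination rule
    turns a refutation of the witness into one of the existential. *)
Lemma consistent_witness q G k :
  In (Ex q) G -> consistent G -> nfresh G <= k ->
  consistent (inst (Var k) q :: G).
Proof.
  intros HG HC Hk HB; apply HC.
  apply prv_exE with q; [now apply prv_hyp |].
  pose proof (prv_subst _ _ HB (fun n => if n =? k then Var 0 else Var (S n))
           (fun X => X)) as HB'; simpl in HB'.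
  assert (E : fsubst (fun n => if n =? k then Var 0 else Var (S n))
           (fun X => X) (inst (Var k) q) = q).
  { unfold inst; rewrite fsubst_comp.
    rewrite <- (fsubst_id q) at 2; apply fsubst_agree; auto.
    intros [|n] Hn; simpl; [now rewrite Nat.eqb_refl |].
    apply nfresh_in in HG; simpl in HG.
    destruct (Nat.eqb_spec n k); auto; lia. }
  rewrite E in HB'.
  erewrite map_ext_in in HB'; [exact HB' |].
  intros p Hp; apply fsubst_agree; auto.
  intros n Hn; apply nfresh_in in Hp; destruct (Nat.eqb_spec n k); auto; lia.
Qed.

Lemma consistent_witnessS q G k :
  In (ExS q) G -> consistent G -> sfresh G <= k ->
  consistent (instS k q :: G).
Proof.
  intros HG HC Hk HB; apply HC.
  apply prv_exSE with q; [now apply prv_hyp |].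
  pose proof (prv_subst _ _ HB Var (fun X => if X =? k then 0 else S X)) as HB'.
  simpl in HB'.
  assert (E : fsubst Var (fun X => if X =? k then 0 else S X) (instS k q) = q).
  { unfold instS; rewrite fsubst_comp.
    rewrite <- (fsubst_id q) at 2; apply fsubst_agree; auto.
    intros [|n] Hn; simpl; [now rewrite Nat.eqb_refl |].
    apply sfresh_in in HG; simpl in HG.
    destruct (Nat.eqb_spec n k); auto; lia. }
  rewrite E in HB'.
  erewrite map_ext_in in HB'; [exact HB' |].
  intros p Hp; apply fsubst_agree; auto.
  intros n Hn; apply sfresh_in in Hp; destruct (Nat.eqb_spec n k); auto; lia.
Qed.

Definition code2 (m n : nat) : nat := to_nat (m, n).

Lemma code2_inj m n m' n' : code2 m n = code2 m' n' -> m = m' /\ n = n'.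
Proof. unfold code2; intros E; apply to_nat_inj in E; split; congruence. Qed.

Fixpoint tcode (t : term) : nat :=
  match t with
  | Var n => code2 0 n
  | Zero => code2 1 0
  | One => code2 2 0
  | Add t u => code2 3 (code2 (tcode t) (tcode u))
  | Mul t u => code2 4 (code2 (tcode t) (tcode u))
  end.

Fixpoint fcode (p : formula) : nat :=
  match p with
  | Eq t u => code2 0 (code2 (tcode t) (tcode u))
  | Lt t u => code2 1 (code2 (tcode t) (tcode u))
  | Mem t X => code2 2 (code2 (tcode t) X)
  | Bot => code2 3 0
  | Imp p q => code2 4 (code2 (fcode p) (fcode q))
  | And p q => code2 5 (code2 (fcode p) (fcode q))
  | Or p q => code2 6 (code2 (fcode p) (fcode q))
  | All p => code2 7 (fcode p)
  | Ex p => code2 8 (fcode p)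
  | AllS p => code2 9 (fcode p)
  | ExS p => code2 10 (fcode p)
  end.

Ltac code_inv :=
  repeat match goal with
  | H : code2 _ _ = code2 _ _ |- _ =>
      apply code2_inj in H; destruct H; try discriminate
  end.

Lemma tcode_inj t : forall u, tcode t = tcode u -> t = u.
Proof. induction t; intros []; simpl; intros E; code_inv; f_equal; auto. Qed.

Lemma fcode_inj p : forall q, fcode p = fcode q -> p = q.
Proof.
  induction p; intros []; simpl; intros E; code_inv; f_equal;
    auto using tcode_inj.
Qed.

Definition witness (p : formula) (G : list formula) : list formula :=
  match p with
  | Ex q => [inst (Var (nfresh G)) q]
  | ExS q => [instS (sfresh G) q]
  | _ => []
  end.

(** A formula inconsistent with the current list may be dropped: the list then
    already derives its negation. *)
Definition decide (p : formula) (G : list formula) : list formula :=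
  if excluded_middle_informative (consistent (p :: G))
  then witness p (p :: G) ++ p :: G else G.

Definition nth_formula (n : nat) : formula :=
  epsilon (inhabits Bot) (fun p => fcode p = n).

Lemma nth_formula_code p : nth_formula (fcode p) = p.
Proof.
  apply fcode_inj.
  apply (epsilon_spec (inhabits Bot) (fun q => fcode q = fcode p)).
  now exists p.
Qed.

Variable G0 : list formula.
Hypothesis G0_consistent : consistent G0.

Fixpoint stage (n : nat) : list formula :=
  match n with 0 => G0 | S n => decide (nth_formula n) (stage n) end.

Lemma decide_consistent p G : consistent G -> consistent (decide p G).
Proof.
  intros HG; unfold decide.
  destruct (excluded_middle_informative _) as [HC|]; auto.
  destruct p; simpl; auto.
  - apply consistent_witness; auto; now left.
  - apply consistent_witnessS; auto; now left.
Qed.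

Lemma stage_consistent n : consistent (stage n).
Proof. induction n; simpl; auto using decide_consistent. Qed.

Lemma decide_incl p G : incl G (decide p G).
Proof.
  unfold decide; destruct (excluded_middle_informative _); intros q Hq; auto.
  apply in_or_app; right; now right.
Qed.

Lemma stage_incl m n : m <= n -> incl (stage m) (stage n).
Proof.
  induction 1; [apply incl_refl |].
  eapply incl_tran; [eassumption | apply decide_incl].
Qed.

(** The stages increase, so this set is closed under derivability with finitely
    many premises. *)
Definition theory (p : formula) : Prop := exists n, prv T (stage n) p.

Lemma theory_stage p : theory p -> exists n, forall m, n <= m -> prv T (stage m) p.
Proof.
  intros [n H]; exists n; intros m Hm.
  now apply prv_weak with (stage n); [| apply stage_incl].
Qed.

Lemma theory_rule1 p q :
  (forall G, prv T G p -> prv T G q) -> theory p -> theory q.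
Proof. intros R [n H]; exists n; auto. Qed.

Lemma theory_rule2 p q r :
  (forall G, prv T G p -> prv T G q -> prv T G r) ->
  theory p -> theory q -> theory r.
Proof.
  intros R Hp Hq; destruct (theory_stage p Hp) as [m Hm].
  destruct (theory_stage q Hq) as [n Hn].
  exists (m + n); apply R; [apply Hm | apply Hn]; lia.
Qed.

Lemma theory_prv p : prv T [] p -> theory p.
Proof. intros H; exists 0; apply prv_weak with []; auto; intros q []. Qed.

Lemma theory_consistent : ~ theory Bot.
Proof. intros [n H]; now apply (stage_consistent n). Qed.

(** Either [p] is consistent with the stage that considers it, and then it is
    added together with its witness, or that stage already refutes it. *)
Lemma theory_decides p :
  theory (Neg p) \/
  theory p /\
  match p with
  | Ex q => exists k, theory (inst (Var k) q)
  | ExS q => exists k, theory (instS k q)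
  | _ => True
  end.
Proof.
  set (G := stage (fcode p)).
  destruct (excluded_middle_informative (consistent (p :: G))) as [HC|HC].
  - assert (E : stage (S (fcode p)) = witness p (p :: G) ++ p :: G).
    { simpl; rewrite nth_formula_code; unfold decide.
      now destruct (excluded_middle_informative _). }
    right; split.
    + exists (S (fcode p)); rewrite E; apply prv_hyp, in_or_app; right; now left.
    + destruct p; auto.
      * exists (nfresh (Ex p :: G)), (S (fcode (Ex p))).
        rewrite E; apply prv_hyp; now left.
      * exists (sfresh (ExS p :: G)), (S (fcode (ExS p))).
        rewrite E; apply prv_hyp; now left.
  - left; exists (fcode p); apply prv_impI; now apply NNPP in HC.
Qed.

Lemma theory_not p : theory (Neg p) <-> ~ theory p.
Proof.
  split.
  - intros Hn Hp; apply theory_consistent; revert Hn Hp.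
    apply theory_rule2; intros G; apply prv_impE.
  - intros Hn; destruct (theory_decides p) as [|[Hp _]]; tauto.
Qed.

Lemma theory_imp p q : theory (Imp p q) <-> (theory p -> theory q).
Proof.
  split.
  - apply theory_rule2; intros G; apply prv_impE.
  - intros H; destruct (classic (theory p)) as [Hp|Hp].
    + specialize (H Hp); revert H; apply theory_rule1; intros G HG.
      apply prv_impI, prv_weak with G; auto; intros x; now right.
    + apply theory_not in Hp; revert Hp; apply theory_rule1; intros G HG.
      apply prv_impI, prv_raa, prv_impE with p.
      * apply prv_weak with G; auto; intros x; simpl; auto.
      * apply prv_hyp; simpl; auto.
Qed.

Lemma theory_and p q : theory (And p q) <-> theory p /\ theory q.
Proof.
  split.
  - split; revert H; apply theory_rule1; intros G;
      [apply prv_andE1 | apply prv_andE2].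
  - intros [Hp Hq]; revert Hp Hq; apply theory_rule2; intros G; apply prv_andI.
Qed.

Lemma theory_or p q : theory (Or p q) <-> theory p \/ theory q.
Proof.
  split.
  - intros H; apply NNPP; intros HN; apply not_or_and in HN as [Hp Hq].
    apply theory_not in Hp, Hq; apply theory_consistent.
    apply theory_rule2 with (3 := H) (p := And (Neg p) (Neg q));
      [| now apply theory_and].
    intros G HN HO; apply prv_orE with p q; auto.
    + apply prv_impE with p; [| apply prv_hyp; now left].
      eapply prv_weak; [eapply prv_andE1, HN | intros x; now right].
    + apply prv_impE with q; [| apply prv_hyp; now left].
      eapply prv_weak; [eapply prv_andE2, HN | intros x; now right].
  - intros [H|H]; revert H; apply theory_rule1; intros G;
      [apply prv_orI1 | apply prv_orI2].
Qed.

Lemma theory_ex p : theory (Ex p) <-> exists t, theory (inst t p).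
Proof.
  split.
  - intros H; destruct (theory_decides (Ex p)) as [Hn|[_ [k Hk]]]; eauto.
    now apply theory_not in Hn.
  - intros [t H]; revert H; apply theory_rule1; intros G; apply prv_exI.
Qed.

Lemma theory_exS p : theory (ExS p) <-> exists X, theory (instS X p).
Proof.
  split.
  - intros H; destruct (theory_decides (ExS p)) as [Hn|[_ [k Hk]]]; eauto.
    now apply theory_not in Hn.
  - intros [t H]; revert H; apply theory_rule1; intros G; apply prv_exSI.
Qed.

(** A maximal theory omitting a universal statement contains the existential
    of its negation, hence a counterexample. *)
Lemma theory_all p : theory (All p) <-> forall t, theory (inst t p).
Proof.
  split.
  - intros H t; revert H; apply theory_rule1; intros G; apply prv_allE.
  - intros H; apply NNPP; intros HN.
    assert (HE : theory (Ex (Neg p))).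
    { apply NNPP; intros HE; apply HN.
      apply theory_not in HE; revert HE; apply theory_rule1; intros G HG.
      apply prv_allI, prv_raa.
      apply prv_impE with (shift (Ex (Neg p))).
      - pose proof (prv_subst _ _ HG (fun n => Var (S n)) (fun X => X)) as HG'.
        eapply prv_weak; [exact HG' | intros x Hx; right; exact Hx].
      - simpl; apply prv_exI with (Var 0); unfold inst; rewrite fsubst_comp.
        simpl; erewrite fsubst_ext; [rewrite fsubst_id | | reflexivity];
          [apply prv_hyp; now left | now intros [|n]]. }
    apply theory_ex in HE as [t Ht].
    exact (proj1 (theory_not (inst t p)) Ht (H t)).
Qed.

Lemma theory_allS p : theory (AllS p) <-> forall X, theory (instS X p).
Proof.
  split.
  - intros H t; revert H; apply theory_rule1; intros G; apply prv_allSE.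
  - intros H; apply NNPP; intros HN.
    assert (HE : theory (ExS (Neg p))).
    { apply NNPP; intros HE; apply HN.
      apply theory_not in HE; revert HE; apply theory_rule1; intros G HG.
      apply prv_allSI, prv_raa.
      apply prv_impE with (shiftS (ExS (Neg p))).
      - pose proof (prv_subst _ _ HG Var S) as HG'.
        eapply prv_weak; [exact HG' | intros x Hx; right; exact Hx].
      - simpl; apply prv_exSI with 0; unfold instS; rewrite fsubst_comp.
        simpl; erewrite fsubst_ext; [rewrite fsubst_id | reflexivity |];
          [apply prv_hyp; now left | now intros [|n]]. }
    apply theory_exS in HE as [X HX].
    exact (proj1 (theory_not (instS X p)) HX (H X)).
Qed.

(** * The term model *)

(** Terms are identified when the theory proves them equal; each class is
    represented by a chosen element, so that equality in the model is equality
    of representatives. *)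
Definition rep (t : term) : term :=
  epsilon (inhabits Zero) (fun u => theory (Eq t u)).

Lemma theory_refl t : theory (Eq t t).
Proof. apply theory_prv, prv_eqI. Qed.

Lemma theory_eqE p t u :
  theory (Eq t u) -> theory (inst t p) -> theory (inst u p).
Proof. apply theory_rule2; intros G; apply prv_eqE. Qed.

Lemma inst_tshift t u : tsubst (scons t Var) (tshift u) = u.
Proof. unfold tshift; rewrite tsubst_comp; apply tsubst_id. Qed.

Lemma theory_sym t u : theory (Eq t u) -> theory (Eq u t).
Proof.
  intros H; pose proof (theory_eqE (Eq (Var 0) (tshift t)) t u H) as E.
  cbn in E; rewrite !inst_tshift in E; apply E, theory_refl.
Qed.

Lemma theory_trans t u v : theory (Eq t u) -> theory (Eq u v) -> theory (Eq t v).
Proof.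
  intros H H'; pose proof (theory_eqE (Eq (tshift t) (Var 0)) u v H') as E.
  cbn in E; rewrite !inst_tshift in E; now apply E.
Qed.

Lemma rep_spec t : theory (Eq t (rep t)).
Proof.
  apply (epsilon_spec (inhabits Zero) (fun u => theory (Eq t u))).
  exists t; apply theory_refl.
Qed.

Lemma rep_eq t u : rep t = rep u <-> theory (Eq t u).
Proof.
  split; intros H.
  - apply theory_trans with (rep t); [apply rep_spec |].
    rewrite H; apply theory_sym, rep_spec.
  - unfold rep; f_equal; apply functional_extensionality; intros v.
    apply propositional_extensionality; split; apply theory_trans; auto.
    now apply theory_sym.
Qed.

Definition class : Type := {t : term | rep t = t}.

Definition cls (t : term) : class :=
  exist _ (rep t) (proj2 (rep_eq (rep t) t) (theory_sym _ _ (rep_spec t))).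

Lemma cls_eq t u : cls t = cls u <-> theory (Eq t u).
Proof.
  rewrite <- rep_eq; split; intros H; [now injection H |].
  unfold cls; apply subset_eq_compat; exact H.
Qed.

Lemma cls_proj (c : class) : cls (proj1_sig c) = c.
Proof. destruct c as [t Ht]; apply subset_eq_compat; exact Ht. Qed.

Lemma theory_proj t : theory (Eq (proj1_sig (cls t)) t).
Proof. apply theory_sym, rep_spec. Qed.

Definition term_model : structure := {|
  num := class;
  set := nat;
  zero := cls Zero;
  one := cls One;
  add c d := cls (Add (proj1_sig c) (proj1_sig d));
  mul c d := cls (Mul (proj1_sig c) (proj1_sig d));
  lt c d := theory (Lt (proj1_sig c) (proj1_sig d));
  mem c X := theory (Mem (proj1_sig c) X);
  some_set := 0
|}.

Ltac leibniz p E H :=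
  pose proof (theory_eqE p _ _ H) as E; unfold inst in E; simpl in E;
  rewrite ?inst_tshift in E.

Lemma theory_add t t' u u' :
  theory (Eq t t') -> theory (Eq u u') -> theory (Eq (Add t u) (Add t' u')).
Proof.
  intros Ht Hu.
  leibniz (Eq (Add (tshift t) (tshift u)) (Add (Var 0) (tshift u))) E1 Ht.
  leibniz (Eq (Add (tshift t) (tshift u)) (Add (tshift t') (Var 0))) E2 Hu.
  apply E2, E1, theory_refl.
Qed.

Lemma theory_mul t t' u u' :
  theory (Eq t t') -> theory (Eq u u') -> theory (Eq (Mul t u) (Mul t' u')).
Proof.
  intros Ht Hu.
  leibniz (Eq (Mul (tshift t) (tshift u)) (Mul (Var 0) (tshift u))) E1 Ht.
  leibniz (Eq (Mul (tshift t) (tshift u)) (Mul (tshift t') (Var 0))) E2 Hu.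
  apply E2, E1, theory_refl.
Qed.

Lemma theory_lt t t' u u' :
  theory (Eq t t') -> theory (Eq u u') ->
  theory (Lt t u) -> theory (Lt t' u').
Proof.
  intros Ht Hu.
  leibniz (Lt (Var 0) (tshift u)) E1 Ht.
  leibniz (Lt (tshift t') (Var 0)) E2 Hu; auto.
Qed.

Lemma theory_mem t t' X :
  theory (Eq t t') -> theory (Mem t X) -> theory (Mem t' X).
Proof. intros Ht; leibniz (Mem (Var 0) X) E1 Ht; auto. Qed.

Lemma eval_term_model s t :
  eval term_model (fun n => cls (s n)) t = cls (tsubst s t).
Proof.
  induction t; simpl; auto; rewrite IHt1, IHt2; apply cls_eq.
  - apply theory_add; apply theory_proj.
  - apply theory_mul; apply theory_proj.
Qed.

(** The statement ranges over all substitutions so that the induction passes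
    under quantifiers, where an element of the model becomes the term put for the
    bound variable. *)
Lemma term_model_truth p : forall s r,
  sat term_model (fun n => cls (s n)) r p <-> theory (fsubst s r p).
Proof.
  induction p; intros s r; cbn [sat fsubst]; rewrite ?eval_term_model.
  - apply cls_eq.
  - split; apply theory_lt; try apply theory_proj;
      apply theory_sym, theory_proj.
  - split; apply theory_mem; [| apply theory_sym]; apply theory_proj.
  - split; [intros [] | apply theory_consistent].
  - now rewrite theory_imp, IHp1, IHp2.
  - now rewrite theory_and, IHp1, IHp2.
  - now rewrite theory_or, IHp1, IHp2.
  - rewrite theory_all; split.
    + intros H t; rewrite inst_up; apply IHp.
      specialize (H (cls t)); revert H; apply sat_ext; auto; now intros [|n].
    + intros H c; specialize (H (proj1_sig c)); rewrite inst_up in H.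
      apply IHp in H; revert H; apply sat_ext; auto.
      intros [|n]; simpl; auto; symmetry; apply cls_proj.
  - rewrite theory_ex; split.
    + intros [c H]; exists (proj1_sig c); rewrite inst_up; apply IHp.
      revert H; apply sat_ext; auto.
      intros [|n]; simpl; auto; apply cls_proj.
    + intros [t H]; exists (cls t); rewrite inst_up in H.
      apply IHp in H; revert H; apply sat_ext; auto; now intros [|n].
  - rewrite theory_allS; split; intros H X; specialize (H X);
      rewrite instS_up in *; now apply IHp.
  - rewrite theory_exS; split; intros [X H]; exists X;
      rewrite instS_up in *; now apply IHp.
Qed.

Lemma term_model_axioms q : T q -> forall e r, sat term_model e r q.
Proof.
  intros Hq e r.
  assert (H : theory (fsubst (fun n => proj1_sig (e n)) r q))
    by now apply theory_prv, prv_ax, T_subst.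
  apply term_model_truth in H; revert H; apply sat_ext; auto.
  intros n; symmetry; apply cls_proj.
Qed.

Lemma term_model_hyp p : In p G0 -> sat term_model (fun n => cls (Var n)) (fun X => X) p.
Proof.
  intros Hp; apply term_model_truth; rewrite fsubst_id.
  exists 0; now apply prv_hyp.
Qed.

End Completeness.

(** If [p] is not derivable then [Neg p] is consistent, and the term model of a
    maximal theory containing it refutes [p].  Closure of [T] under substitution
    makes the free variables of axioms universal in that model. *)
Theorem completeness (T : formula -> Prop) (p : formula) :
  (forall s r q, T q -> T (fsubst s r q)) ->
  (forall M, (forall q, T q -> forall e r, sat M e r q) ->
             forall e r, sat M e r p) ->
  proves T p.
Proof.
  intros HT HM; apply prv_raa, NNPP; intros HC.
  specialize (HM (term_model T [Neg p]) (term_model_axioms T HT _ HC)).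
  apply (term_model_hyp T HT _ HC (Neg p)); [now left | apply HM].
Qed.

(** * Substitution instances of the axioms *)

Lemma Delta00_subst p : Delta00 p -> forall s r, Delta00 (fsubst s r p).
Proof.
  induction 1; intros s r; simpl; try constructor; auto.
  - rewrite tsubst_up_shift; constructor; auto.
  - rewrite tsubst_up_shift; constructor; auto.
Qed.

Lemma fsubst_induction s r p :
  fsubst s r (induction p) = induction (fsubst (up s) r p).
Proof.
  unfold induction; simpl; rewrite fsubst_inst, !fsubst_comp.
  simpl; do 4 f_equal; apply fsubst_ext; auto.
  intros [|n]; simpl; auto; unfold tshift; rewrite tsubst_comp.
  now apply tsubst_ext.
Qed.

Lemma fsubst_comprehension s r p q :
  fsubst s r (comprehension p q) =
  comprehension (fsubst (up s) r p) (fsubst (up s) r q).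
Proof. unfold comprehension; simpl; now rewrite fsubst_shiftS. Qed.

Lemma RCA0_subst s r q : RCA0 q -> RCA0 (fsubst s r q).
Proof.
  intros [p Hp | p Hp | p p' Hp Hp'].
  - apply ax_basic; destruct Hp; constructor.
  - rewrite fsubst_induction; apply ax_induction.
    destruct Hp; simpl; constructor; now apply Delta00_subst.
  - rewrite fsubst_comprehension; apply ax_comprehension.
    + destruct Hp; simpl; constructor; now apply Delta00_subst.
    + destruct Hp'; simpl; constructor; now apply Delta00_subst.
Qed.

Lemma RCA0_RP_subst s r q : extend RCA0 RP q -> extend RCA0 RP (fsubst s r q).
Proof.
  intros [H | ->]; [left; now apply RCA0_subst | right; reflexivity].
Qed.

(** * Bounded definability with parameters *)

Fixpoint mix {A : Type} (e par : nat -> A) (n : nat) : A :=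
  match n with
  | 0 => e 0
  | 1 => par 0
  | S (S n) => mix (fun k => e (S k)) (fun k => par (S k)) n
  end.

Lemma mix_even {A} n : forall e par : nat -> A, mix e par (2 * n) = e n.
Proof.
  induction n; intros e par; auto.
  replace (2 * S n) with (S (S (2 * n))) by lia; cbn [mix]; now rewrite IHn.
Qed.

Lemma mix_odd {A} n : forall e par : nat -> A, mix e par (2 * n + 1) = par n.
Proof.
  induction n; intros e par; auto.
  replace (2 * S n + 1) with (S (S (2 * n + 1))) by lia.
  cbn [mix]; now rewrite IHn.
Qed.

Ltac parity n :=
  let k := fresh "k" in
  destruct (Nat.Even_or_Odd n) as [[k ->]|[k ->]].

Lemma even_2n n : Nat.even (2 * n) = true.
Proof. now rewrite Nat.even_mul. Qed.
Lemma even_2n1 n : Nat.even (2 * n + 1) = false.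
Proof. now rewrite Nat.even_add, even_2n. Qed.

Definition renL (n : nat) : nat := if Nat.even n then n else 2 * n - 1.
Definition renR (n : nat) : nat := if Nat.even n then n else 2 * n + 1.

Lemma mix_renL {A} (e a b : nat -> A) n :
  mix e (mix a b) (renL n) = mix e a n.
Proof.
  unfold renL; parity n; rewrite ?even_2n, ?even_2n1, ?mix_even; auto.
  replace (2 * (2 * k + 1) - 1) with (2 * (2 * k) + 1) by lia.
  now rewrite !mix_odd, mix_even.
Qed.

Lemma mix_renR {A} (e a b : nat -> A) n :
  mix e (mix a b) (renR n) = mix e b n.
Proof.
  unfold renR; parity n; rewrite ?even_2n, ?even_2n1, ?mix_even; auto.
  now rewrite !mix_odd.
Qed.

Declare Scope num_scope.
Delimit Scope num_scope with num.

Section Model.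

Variable M : structure.
Hypothesis M_RCA0 : forall q, RCA0 q -> forall e r, sat M e r q.

Bind Scope num_scope with num.
Local Open Scope num_scope.
Local Notation "0" := (@zero M) : num_scope.
Local Notation "1" := (@one M) : num_scope.
Local Notation "x + y" := (@add M x y) : num_scope.
Local Notation "x * y" := (@mul M x y) : num_scope.
Local Notation "x < y" := (@lt M x y) : num_scope.
Local Notation "x ∈ X" := (@mem M x X) (at level 70) : num_scope.
Local Notation N := (num M).
Local Notation env := (nat -> num M).

(** Variables and parameters are interleaved in the environment, so that
    formulas with different parameters can be brought together by renaming. *)
Definition Delta0 (P : env -> Prop) : Prop :=
  exists p par r, Delta00 p /\ forall e, sat M (mix e par) r p <-> P e.

Definition Term (t : env -> N) : Prop :=
  exists u par, forall e, eval M (mix e par) u = t e.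

Lemma Term_var n : Term (fun e => e n).
Proof.
  exists (Var (2 * n)), (fun _ => 0); intros e; cbn [eval]; apply mix_even.
Qed.

Lemma Term_const c : Term (fun _ => c).
Proof. exists (Var 1), (fun _ => c); reflexivity. Qed.

Definition rename (f : nat -> nat) : nat -> term := fun n => Var (f n).

Lemma Term_merge t u : Term t -> Term u ->
  exists v w par, forall e,
    eval M (mix e par) v = t e /\ eval M (mix e par) w = u e.
Proof.
  intros (v & a & Hv) (w & b & Hw).
  exists (tsubst (rename renL) v), (tsubst (rename renR) w), (mix a b).
  intros e; rewrite !eval_tsubst, <- Hv, <- Hw; split; apply eval_ext; intros n.
  - apply mix_renL.
  - apply mix_renR.
Qed.

Lemma Term_add t u : Term t -> Term u -> Term (fun e => t e + u e).
Proof.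
  intros Ht Hu; destruct (Term_merge t u Ht Hu) as (v & w & par & H).
  exists (Add v w), par; intros e; simpl; now destruct (H e) as [-> ->].
Qed.

Lemma Term_mul t u : Term t -> Term u -> Term (fun e => t e * u e).
Proof.
  intros Ht Hu; destruct (Term_merge t u Ht Hu) as (v & w & par & H).
  exists (Mul v w), par; intros e; simpl; now destruct (H e) as [-> ->].
Qed.

Lemma Delta0_eq t u : Term t -> Term u -> Delta0 (fun e => t e = u e).
Proof.
  intros Ht Hu; destruct (Term_merge t u Ht Hu) as (v & w & par & H).
  exists (Eq v w), par, (fun _ => some_set M); split; [constructor |].
  intros e; simpl; now destruct (H e) as [-> ->].
Qed.

Lemma Delta0_lt t u : Term t -> Term u -> Delta0 (fun e => t e < u e).
Proof.
  intros Ht Hu; destruct (Term_merge t u Ht Hu) as (v & w & par & H).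
  exists (Lt v w), par, (fun _ => some_set M); split; [constructor |].
  intros e; simpl; now destruct (H e) as [-> ->].
Qed.

Lemma Delta0_mem t X : Term t -> Delta0 (fun e => t e ∈ X).
Proof.
  intros (v & par & H).
  exists (Mem v 0), par, (fun _ => X); split; [constructor |].
  intros e; simpl; now rewrite H.
Qed.

Lemma Delta0_ext (P Q : env -> Prop) :
  (forall e, P e <-> Q e) -> Delta0 P -> Delta0 Q.
Proof.
  intros E (p & par & r & Hp & H); exists p, par, r; split; auto.
  intros e; now rewrite H.
Qed.

Lemma Delta0_const (A : Prop) : Delta0 (fun _ => A).
Proof.
  destruct (classic A) as [HA|HA].
  - apply Delta0_ext with (fun _ => 0 = 0); [tauto |].
    apply Delta0_eq; apply Term_const.
  - exists Bot, (fun _ => 0), (fun _ => some_set M); split; [constructor |].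
    intros e; simpl; tauto.
Qed.

Lemma Delta0_merge P Q : Delta0 P -> Delta0 Q ->
  exists p q par r, Delta00 p /\ Delta00 q /\
    (forall e, sat M (mix e par) r p <-> P e) /\
    (forall e, sat M (mix e par) r q <-> Q e).
Proof.
  intros (p & a & r & Hp & HP) (q & b & s & Hq & HQ).
  exists (fsubst (rename renL) (fun X => 2 * X)%nat p),
    (fsubst (rename renR) (fun X => 2 * X + 1)%nat q), (mix a b), (mix r s).
  repeat split; try (now apply Delta00_subst); try (rewrite sat_fsubst);
    intros H; apply HP || apply HQ || (apply sat_fsubst; apply HP in H || apply HQ in H).
  all: revert H; rewrite ?sat_fsubst; apply sat_ext; intros n;
    unfold rename; cbn [eval];
    rewrite ?mix_renL, ?mix_renR, ?mix_even, ?mix_odd; reflexivity.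
Qed.

Lemma Delta0_and P Q : Delta0 P -> Delta0 Q -> Delta0 (fun e => P e /\ Q e).
Proof.
  intros HP HQ; destruct (Delta0_merge P Q HP HQ) as (p & q & a & r & Hp & Hq & E & F).
  exists (And p q), a, r; split; [now constructor |].
  intros e; simpl; now rewrite E, F.
Qed.

Lemma Delta0_or P Q : Delta0 P -> Delta0 Q -> Delta0 (fun e => P e \/ Q e).
Proof.
  intros HP HQ; destruct (Delta0_merge P Q HP HQ) as (p & q & a & r & Hp & Hq & E & F).
  exists (Or p q), a, r; split; [now constructor |].
  intros e; simpl; now rewrite E, F.
Qed.

Lemma Delta0_imp P Q : Delta0 P -> Delta0 Q -> Delta0 (fun e => P e -> Q e).
Proof.
  intros HP HQ; destruct (Delta0_merge P Q HP HQ) as (p & q & a & r & Hp & Hq & E & F).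
  exists (Imp p q), a, r; split; [now constructor |].
  intros e; simpl; now rewrite E, F.
Qed.

Lemma Delta0_not P : Delta0 P -> Delta0 (fun e => ~ P e).
Proof. intros HP; apply Delta0_imp; auto using Delta0_const. Qed.

Lemma Delta0_iff P Q : Delta0 P -> Delta0 Q -> Delta0 (fun e => P e <-> Q e).
Proof. intros HP HQ; apply Delta0_and; now apply Delta0_imp. Qed.

(** The bound lives in the outer environment and the matrix in the one
    extended by the bound variable; [renB] moves the parameters of the matrix
    past both. *)
Definition renB (n : nat) : nat :=
  if Nat.even n then Nat.pred n else S (2 * n + 1).

Lemma mix_renB (e a b : env) y n :
  scons y (mix e (mix a b)) (renB n) = mix (scons y e) b n.
Proof.
  unfold renB; parity n; rewrite ?even_2n, ?even_2n1.
  - destruct k as [|k]; auto; rewrite mix_even.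
    replace (Nat.pred (2 * S k)) with (S (2 * k)) by lia.
    cbn [scons]; apply mix_even.
  - cbn [scons]; now rewrite !mix_odd.
Qed.

Lemma Delta0_merge_bound t (P : env -> N -> Prop) :
  Term t -> Delta0 (fun e => P (fun n => e (S n)) (e O)) ->
  exists u p par r, Delta00 p /\
    (forall e, eval M (mix e par) u = t e) /\
    (forall e y, sat M (scons y (mix e par)) r p <-> P e y).
Proof.
  intros (u & a & Hu) (p & b & r & Hp & HP).
  exists (tsubst (rename renL) u), (fsubst (rename renB) (fun X => X) p),
    (mix a b), r; repeat split.
  - now apply Delta00_subst.
  - intros e; rewrite eval_tsubst, <- Hu; apply eval_ext; intros n.
    apply mix_renL.
  - intros H; apply (HP (scons y e)); rewrite sat_fsubst in H; revert H.
    apply sat_ext; auto; intros n; symmetry; apply mix_renB.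
  - intros H; apply (HP (scons y e)) in H; rewrite sat_fsubst; revert H.
    apply sat_ext; auto; intros n; apply mix_renB.
Qed.

Lemma Delta0_ball t (P : env -> N -> Prop) :
  Term t -> Delta0 (fun e => P (fun n => e (S n)) (e O)) ->
  Delta0 (fun e => forall y, y < t e -> P e y).
Proof.
  intros Ht HP.
  destruct (Delta0_merge_bound t P Ht HP) as (u & p & par & r & Hp & Hu & H).
  exists (All (Imp (Lt (Var O) (tshift u)) p)), par, r; split; [now constructor |].
  intros e; cbn [sat eval]; split; intros G y Hy.
  - apply H, G; unfold tshift; rewrite eval_tsubst; simpl.
    rewrite <- Hu in Hy; exact Hy.
  - apply H, G; rewrite <- Hu; unfold tshift in Hy; rewrite eval_tsubst in Hy.
    exact Hy.
Qed.

Lemma Delta0_bex t (P : env -> N -> Prop) :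
  Term t -> Delta0 (fun e => P (fun n => e (S n)) (e O)) ->
  Delta0 (fun e => exists y, y < t e /\ P e y).
Proof.
  intros Ht HP.
  apply Delta0_ext with (fun e => ~ forall y, y < t e -> ~ P e y).
  - intros e; split.
    + intros G; apply NNPP; intros F; apply G; intros y Hy HPy; eauto.
    + intros (y & Hy & HPy) G; now apply (G y).
  - apply Delta0_not, (Delta0_ball t (fun e y => ~ P e y)); auto.
    now apply Delta0_not.
Qed.

Lemma Term_shift t : Term t -> Term (fun e => t (fun n => e (S n))).
Proof.
  intros (u & par & H).
  exists (tsubst (rename (fun n => if Nat.even n then (2 + n)%nat else n)) u), par.
  intros e; rewrite eval_tsubst, <- H; apply eval_ext; intros n.
  unfold rename; cbn [eval].
  parity n; rewrite ?even_2n, ?even_2n1, ?mix_odd, ?mix_even; auto.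
  replace (2 + 2 * k)%nat with (2 * S k)%nat by lia; now rewrite mix_even.
Qed.

(** Derives definability from the shape of a predicate; [delta0_atom] is redefined
    as further relations are shown to be definable. *)
Ltac delta0_atom := fail.

Ltac delta0 :=
  cbn beta;
  lazymatch goal with
  | |- Term (fun e => e ?n) => apply (Term_var n)
  | |- Term (fun e => @?t e + @?u e) => apply (Term_add t u); delta0
  | |- Term (fun e => @?t e * @?u e) => apply (Term_mul t u); delta0
  | |- Term (fun _ => ?c) => apply (Term_const c)
  | |- Delta0 (fun _ => ?A) => apply (Delta0_const A)
  | |- Delta0 (fun e => forall y, y < @?t e -> @?P e y) =>
      apply (Delta0_ball t P); delta0
  | |- Delta0 (fun e => exists y, y < @?t e /\ @?P e y) =>
      apply (Delta0_bex t P); delta0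
  | |- Delta0 (fun e => @?P e /\ @?Q e) => apply (Delta0_and P Q); delta0
  | |- Delta0 (fun e => @?P e \/ @?Q e) => apply (Delta0_or P Q); delta0
  | |- Delta0 (fun e => @?P e <-> @?Q e) => apply (Delta0_iff P Q); delta0
  | |- Delta0 (fun e => ~ @?P e) => apply (Delta0_not P); delta0
  | |- Delta0 (fun e => @?P e -> @?Q e) => apply (Delta0_imp P Q); delta0
  | |- Delta0 (fun e => @?t e = @?u e) => apply (Delta0_eq t u); delta0
  | |- Delta0 (fun e => @?t e < @?u e) => apply (Delta0_lt t u); delta0
  | |- Delta0 (fun e => @?t e ∈ ?X) => apply (Delta0_mem t X); delta0
  | _ => delta0_atom; delta0
  end.

(** * Induction and comprehension for definable predicates *)

Definition env2 (y x : N) (par : env) : env := scons y (scons x par).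

(** Back from interleaving to the layout of the axiom schemes, where the witness
    is variable 0, the distinguished variable is 1 and the parameters follow. *)
Lemma Delta0_pair p par r :
  exists p', (Delta00 p -> Delta00 p') /\ forall x y,
    sat M (env2 y x par) r p' <-> sat M (mix (env2 y x (fun _ => x)) par) r p.
Proof.
  exists (fsubst (rename (fun n => if Nat.even n
            then match Nat.div2 n with 0%nat => 0%nat | _ => 1%nat end
            else (2 + Nat.div2 n)%nat)) (fun X => X) p).
  split; [intros H; now apply Delta00_subst |].
  intros x y; rewrite sat_fsubst; apply sat_ext; auto; intros n.
  unfold rename; cbn [eval]; parity n; rewrite ?even_2n, ?even_2n1.
  - rewrite Nat.div2_double, mix_even; now destruct k as [|[|k]].
  - rewrite mix_odd, Nat.add_1_r, Nat.div2_succ_double; reflexivity.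
Qed.

(** An existential predicate is given through its bounded matrix; in the
    environment the witness precedes the induction variable. *)
Theorem Sigma1_induction (Q : N -> N -> Prop) :
  Delta0 (fun e => Q (e 1%nat) (e 0%nat)) ->
  (exists y, Q 0 y) ->
  (forall x, (exists y, Q x y) -> exists y, Q (x + 1) y) ->
  forall x, exists y, Q x y.
Proof.
  intros (p & par & r & Hp & HQ) H0 HS.
  destruct (Delta0_pair p par r) as (p' & Hp' & E).
  assert (F : forall x, sat M (scons x par) r (Ex p') <-> exists y, Q x y).
  { intros x; cbn [sat]; split; intros [y Hy]; exists y.
    - apply E, HQ in Hy; exact Hy.
    - apply E, HQ; exact Hy. }
  pose proof (M_RCA0 _ (ax_induction (Ex p') (Sigma01_ex _ (Hp' Hp))) par r) as I.
  unfold induction in I.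
  intros x; apply F; revert x; apply I; split.
  - unfold inst; rewrite sat_fsubst; rewrite <- (F 0) in H0; revert H0.
    apply sat_ext; auto; now intros [|n].
  - intros x Hx; rewrite sat_fsubst; apply F, HS, F in Hx; revert Hx.
    apply sat_ext; auto; now intros [|n].
Qed.

Theorem Delta0_induction (P : N -> Prop) :
  Delta0 (fun e => P (e 0%nat)) ->
  P 0 -> (forall x, P x -> P (x + 1)) -> forall x, P x.
Proof.
  intros (p & par & r & Hp & HP) H0 HS x.
  assert (H : exists y, y = 0 /\ P x); [| now destruct H as (y & _ & H)].
  revert x; apply Sigma1_induction.
  - apply (Delta0_and (fun e => e 0%nat = 0) (fun e => P (e 1%nat))); [delta0 |].
    exists (fsubst (rename (fun n => if Nat.even n then (2 + n)%nat else n))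
              (fun X => X) p), par, r; split; [now apply Delta00_subst |].
    intros e; rewrite sat_fsubst, <- (HP (fun n => e (S n))).
    apply sat_ext; auto; intros n; unfold rename; cbn [eval].
    parity n; rewrite ?even_2n, ?even_2n1, ?mix_odd, ?mix_even; auto.
    replace (2 + 2 * k)%nat with (2 * S k)%nat by lia; now rewrite mix_even.
  - eauto.
  - intros x (y & Hy & Hx); eauto.
Qed.

Theorem Delta1_comprehension (Q R : N -> N -> Prop) :
  Delta0 (fun e => Q (e 1%nat) (e 0%nat)) ->
  Delta0 (fun e => R (e 1%nat) (e 0%nat)) ->
  (forall x, (exists y, Q x y) <-> (forall y, R x y)) ->
  exists X, forall x, x ∈ X <-> exists y, Q x y.
Proof.
  intros HQ HR E.
  destruct (Delta0_merge _ _ HQ HR) as (p & q & par & r & Hp & Hq & EQ & ER).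
  destruct (Delta0_pair p par r) as (p' & Hp' & EP).
  destruct (Delta0_pair q par r) as (q' & Hq' & EQ').
  assert (F : forall x y, sat M (env2 y x par) r p' <-> Q x y).
  { intros x y; rewrite EP, EQ; reflexivity. }
  assert (G : forall x y, sat M (env2 y x par) r q' <-> R x y).
  { intros x y; rewrite EQ', ER; reflexivity. }
  destruct (M_RCA0 _ (ax_comprehension (Ex p') (All q') (Sigma01_ex _ (Hp' Hp))
                        (Pi01_all _ (Hq' Hq))) par r) as [X HX].
  - intros x; change ((exists y, sat M (env2 y x par) r p') <->
                      (forall y, sat M (env2 y x par) r q')).
    split.
    + intros [y Hy] z; apply G; revert z; apply E; exists y; now apply F.
    + intros H; destruct (proj2 (E x)) as [y Hy];
        [intros y; now apply G | exists y; now apply F].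
  - exists X; intros x; specialize (HX x); unfold shiftS in HX.
    assert (H : (exists y, Q x y) <->
              sat M (scons x par) (scons X r) (fsubst Var S (Ex p'))).
    { rewrite sat_fsubst; change ((exists y, Q x y) <->
        exists y, sat M (scons y (fun n => scons x par n)) (fun n => r n) p').
      split; intros [y Hy]; exists y; revert Hy; rewrite <- F;
        apply sat_ext; auto; now intros [|[|n]]. }
    rewrite H; exact HX.
Qed.


(** * Ordered semiring *)

Local Notation "x <= y" := (x < y + 1) : num_scope.

Ltac induct x :=
  revert x; refine (Delta0_induction _ _ _ _); cbn beta; [delta0 | |].

Ltac axiom_of_RCA0 a :=
  exact (M_RCA0 _ (ax_basic _ a) (fun _ => 0) (fun _ => some_set M)).

Lemma num_succ_neq0 : forall x, x + 1 <> 0.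
Proof. axiom_of_RCA0 succ_neq0. Qed.
Lemma num_succ_inj : forall x y, x + 1 = y + 1 -> x = y.
Proof. axiom_of_RCA0 succ_inj. Qed.
Lemma num_add_0 : forall x, x + 0 = x.
Proof. axiom_of_RCA0 add_0. Qed.
Lemma num_add_succ : forall x y, x + (y + 1) = (x + y) + 1.
Proof. axiom_of_RCA0 add_succ. Qed.
Lemma num_mul_0 : forall x, x * 0 = 0.
Proof. axiom_of_RCA0 mul_0. Qed.
Lemma num_mul_succ : forall x y, x * (y + 1) = x * y + x.
Proof. axiom_of_RCA0 mul_succ. Qed.
Lemma num_lt_0 : forall x, ~ x < 0.
Proof. axiom_of_RCA0 lt_0. Qed.
Lemma num_lt_succ : forall x y, x < y + 1 <-> (x < y \/ x = y).
Proof. axiom_of_RCA0 lt_succ. Qed.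

Lemma num_0_add x : 0 + x = x.
Proof.
  induct x; [apply num_add_0 |].
  intros x H; now rewrite num_add_succ, H.
Qed.

Lemma num_succ_add x y : (x + 1) + y = (x + y) + 1.
Proof.
  induct y; [now rewrite !num_add_0 |].
  intros y H; now rewrite !num_add_succ, H.
Qed.

Lemma num_add_comm x y : x + y = y + x.
Proof.
  induct y; [now rewrite num_add_0, num_0_add |].
  intros y H; now rewrite num_add_succ, H, num_succ_add.
Qed.

Lemma num_add_assoc x y z : x + (y + z) = (x + y) + z.
Proof.
  induct z; [now rewrite !num_add_0 |].
  intros z H; now rewrite !num_add_succ, H.
Qed.

Lemma num_0_mul x : 0 * x = 0.
Proof.
  induct x; [apply num_mul_0 |].
  intros x H; now rewrite num_mul_succ, H, num_add_0.
Qed.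

Lemma num_succ_mul x y : (x + 1) * y = x * y + y.
Proof.
  induct y; [now rewrite !num_mul_0, num_add_0 |].
  intros y H; rewrite !num_mul_succ, H, !num_add_succ; f_equal.
  rewrite <- !num_add_assoc; f_equal; apply num_add_comm.
Qed.

Lemma num_mul_comm x y : x * y = y * x.
Proof.
  induct y; [now rewrite num_mul_0, num_0_mul |].
  intros y H; now rewrite num_mul_succ, H, num_succ_mul.
Qed.

Lemma num_mul_add x y z : (x + y) * z = x * z + y * z.
Proof.
  induct z; [now rewrite !num_mul_0, num_add_0 |].
  intros z H; rewrite !num_mul_succ, H, <- !num_add_assoc; f_equal.
  rewrite !num_add_assoc; f_equal; apply num_add_comm.
Qed.

Lemma num_mul_assoc x y z : x * (y * z) = (x * y) * z.
Proof.
  induct z; [now rewrite !num_mul_0 |].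
  intros z H; rewrite !num_mul_succ, <- H.
  now rewrite num_mul_comm, num_mul_add, (num_mul_comm x), (num_mul_comm x).
Qed.

Lemma num_semiring : semi_ring_theory 0 1 (@add M) (@mul M) eq.
Proof.
  constructor; auto using num_0_add, num_add_comm, num_add_assoc, num_0_mul,
    num_mul_comm, num_mul_assoc, num_mul_add.
  intros x; rewrite num_mul_comm, <- (num_0_add 1), num_mul_succ, num_mul_0.
  apply num_0_add.
Qed.

Add Ring num_ring : num_semiring.

Lemma num_add_cancel x y z : x + z = y + z -> x = y.
Proof.
  induct z; [now rewrite !num_add_0 |].
  intros z H E; apply H, num_succ_inj; now rewrite <- !num_add_succ.
Qed.

Lemma num_lt_add x d : x < x + d + 1.
Proof.
  induct d.
  - apply num_lt_succ; right; ring.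
  - intros d H; apply num_lt_succ; left; now rewrite num_add_assoc.
Qed.

Lemma num_lt_diff x y : x < y <-> exists d, y = x + d + 1.
Proof.
  split; [| intros [d ->]; apply num_lt_add].
  assert (H : exists d, x < y -> y = x + d + 1).
  { revert y; refine (Sigma1_induction _ _ _ _); cbn beta; [delta0 | |].
    - exists 0; intros H; now apply num_lt_0 in H.
    - intros y [d Hd]; destruct (classic (x < y)) as [Hxy|Hxy].
      + exists (d + 1); intros _; rewrite (Hd Hxy) at 1; ring.
      + exists 0; intros H; apply num_lt_succ in H as [H|H]; [tauto |].
        subst; ring. }
  destruct H as [d Hd]; eauto.
Qed.

Lemma num_case x : x = 0 \/ exists y, x = y + 1.
Proof.
  destruct (classic (x = 0)) as [|H]; auto; right.
  assert (E : exists y, x = 0 \/ x = y + 1); [| destruct E as [y []]; eauto; tauto].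
  clear H; revert x; refine (Sigma1_induction _ _ _ _); cbn beta; [delta0 | |].
  - exists 0; auto.
  - intros x _; exists x; auto.
Qed.

(** The inequality as a difference, the form in which rows are added up. *)
Definition leq (x y : N) : Prop := exists d, y = x + d.

Lemma lt_leq x y : x < y -> leq (x + 1) y.
Proof. intros H; apply num_lt_diff in H as [d ->]; exists d; ring. Qed.

Lemma eq_leq x y : x = y -> leq x y /\ leq y x.
Proof. intros ->; split; exists 0; ring. Qed.

Lemma num_lt_trichotomy x y : x < y \/ x = y \/ y < x.
Proof.
  induct y.
  - destruct (num_case x) as [->|[y ->]]; auto.
    right; right; apply num_lt_diff; exists y; ring.
  - intros y [H|[<-|H]].
    + left; apply num_lt_succ; auto.
    + left; apply num_lt_succ; auto.
    + apply num_lt_diff in H as [d ->].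
      destruct (num_case d) as [->|[c ->]]; [right; left; ring |].
      right; right; apply num_lt_diff; exists c; ring.
Qed.

Lemma num_lt_or_le x y : x < y \/ y <= x.
Proof.
  destruct (num_lt_trichotomy x y) as [H|[H|H]]; auto; right;
    apply num_lt_succ; auto.
Qed.

Lemma num_not_lt x y : ~ x < y -> y <= x.
Proof. destruct (num_lt_or_le x y); tauto. Qed.

Lemma num_add_neq x d : x <> x + d + 1.
Proof.
  intros E; apply (num_succ_neq0 d), (num_add_cancel _ _ x).
  transitivity (x + d + 1); [ring | rewrite <- E; ring].
Qed.

Lemma num_le_antisym x y : x <= y -> y <= x -> x = y.
Proof.
  intros H K; apply num_lt_succ in H as [H|H]; auto.
  apply num_lt_succ in K as [K|K]; auto.
  apply num_lt_diff in H as [d ->], K as [c E].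
  exfalso; apply (num_add_neq x (d + c + 1)); rewrite E at 1; ring.
Qed.

(** * Linear arithmetic *)

(** Consequences of linear inequalities are found by Fourier-Motzkin elimination
    on coefficients that are genuine natural numbers, whatever the numbers of the
    structure are.  A strict inequality [x < y] enters as [x + 1 <= y], which is
    how discreteness is used.

    A row [(L, R)] is the inequality between the linear forms with coefficient
    lists [L] and [R], constant coefficient first.  Subtraction is avoided by
    keeping both sides. *)
Definition row : Type := (list nat * list nat)%type.

Fixpoint nmul (n : nat) (x : N) : N :=
  match n with O => 0 | S n => x + nmul n x end.

Fixpoint dot (c : list nat) (v : list N) : N :=
  match c, v with
  | a :: c, x :: v => nmul a x + dot c v
  | _, _ => 0
  end.

Definition holds (v : list N) (p : row) : Prop :=
  leq (dot (fst p) v) (dot (snd p) v).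

Fixpoint padd (c d : list nat) : list nat :=
  match c, d with
  | a :: c, b :: d => (a + b)%nat :: padd c d
  | [], d => d
  | c, [] => c
  end.

Definition pscale (k : nat) (c : list nat) : list nat := map (Nat.mul k) c.

Fixpoint cancel (c d : list nat) : row :=
  match c, d with
  | a :: c, b :: d =>
      let (c', d') := cancel c d in ((a - b)%nat :: c', (b - a)%nat :: d')
  | c, d => (c, d)
  end.

Lemma nmul_add m n x : nmul (m + n) x = nmul m x + nmul n x.
Proof. induction m; simpl; [ring | rewrite IHm; ring]. Qed.

Lemma nmul_mul m n x : nmul (m * n) x = nmul m (nmul n x).
Proof. induction m; simpl; auto; now rewrite nmul_add, IHm. Qed.

Lemma nmul_distr n x y : nmul n (x + y) = nmul n x + nmul n y.
Proof. induction n; simpl; [ring | rewrite IHn; ring]. Qed.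

Lemma nmul_0 n : nmul n 0 = 0.
Proof. induction n; simpl; [auto | rewrite IHn; ring]. Qed.

Lemma dot_padd v : forall c d, dot (padd c d) v = dot c v + dot d v.
Proof.
  induction v; intros [|a' c] [|b d]; simpl; try ring.
  rewrite IHv, nmul_add; ring.
Qed.

Lemma dot_pscale k v : forall c, dot (pscale k c) v = nmul k (dot c v).
Proof.
  induction v; intros [|a' c]; simpl; rewrite ?nmul_0; auto.
  fold (pscale k c); now rewrite IHv, nmul_mul, nmul_distr.
Qed.

Lemma dot_nil c : dot c [] = 0.
Proof. now destruct c. Qed.

Lemma dot_cancel v : forall c d, exists z,
  dot c v = dot (fst (cancel c d)) v + z /\
  dot d v = dot (snd (cancel c d)) v + z.
Proof.
  induction v as [|x v IH].
  { intros c d; rewrite !dot_nil; exists 0; split; ring. }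
  intros [|a c] [|b d]; simpl; try (exists 0; split; ring);
    destruct (IH c d) as (z & E & F); destruct (cancel c d) as [c' d']; simpl in *.
  rewrite E, F; exists (nmul (Nat.min a b) x + z); split.
    + replace a with (Nat.min a b + (a - b))%nat at 1 by lia.
      rewrite nmul_add; ring.
    + replace b with (Nat.min a b + (b - a))%nat at 1 by lia.
      rewrite nmul_add; ring.
Qed.

Lemma holds_cancel v c d : leq (dot c v) (dot d v) -> holds v (cancel c d).
Proof.
  intros [z E]; destruct (dot_cancel v c d) as (y & E1 & E2).
  exists z; apply (num_add_cancel _ _ y); rewrite <- E2, E, E1; ring.
Qed.

Definition at_var (k : nat) (c : list nat) : nat := nth k c O.

Definition combine (k : nat) (p q : row) : row :=
  let a := at_var k (fst p) in
  let b := at_var k (snd q) in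
  cancel (padd (pscale b (fst p)) (pscale a (fst q)))
         (padd (pscale b (snd p)) (pscale a (snd q))).

Lemma nmul_leq n x y : leq x y -> leq (nmul n x) (nmul n y).
Proof. intros [d ->]; exists (nmul n d); apply nmul_distr. Qed.

Lemma holds_combine v k p q : holds v p -> holds v q -> holds v (combine k p q).
Proof.
  intros Hp Hq; apply holds_cancel; rewrite !dot_padd, !dot_pscale.
  apply (nmul_leq (at_var k (snd q))) in Hp as [d ->].
  apply (nmul_leq (at_var k (fst p))) in Hq as [c ->].
  exists (d + c); ring.
Qed.

Definition unit_var (k : nat) : list nat := repeat O k ++ [1%nat].

Definition row_eqb (p q : row) : bool :=
  if list_eq_dec Nat.eq_dec (fst p) (fst q)
  then if list_eq_dec Nat.eq_dec (snd p) (snd q) then true else false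
  else false.

Fixpoint dedupe (l : list row) : list row :=
  match l with
  | [] => []
  | p :: l => let l' := dedupe l in
      if (forallb (Nat.eqb 0) (fst p) || existsb (row_eqb p) l')%bool
      then l' else p :: l'
  end.

(** One Fourier-Motzkin step; [unit_var k] is the fact that a number is not
    negative. *)
Definition eliminate (k : nat) (l : list row) : list row :=
  let pos := filter (fun p => negb (at_var k (fst p) =? 0)%nat) l in
  let neg := ([], unit_var k) ::
             filter (fun p => negb (at_var k (snd p) =? 0)%nat) l in
  let rest := filter (fun p => (at_var k (fst p) =? 0)%nat &&
                               (at_var k (snd p) =? 0)%nat)%bool l in
  dedupe (flat_map (fun p => map (combine k p) neg) pos ++ rest).

Definition cost (k : nat) (l : list row) : nat :=
  (length (filter (fun p => negb (at_var k (fst p) =? 0)%nat) l) *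
   length (filter (fun p => negb (at_var k (snd p) =? 0)%nat) l))%nat.

Definition cheapest (ks : list nat) (l : list row) : nat :=
  fold_right (fun k j => if (cost k l <=? cost j l)%nat then k else j)
    (hd O ks) ks.

Definition absurd_row (p : row) : bool :=
  negb (at_var 0 (fst p) =? 0)%nat && forallb (Nat.eqb 0) (snd p).

Fixpoint refute (fuel : nat) (ks : list nat) (l : list row) : bool :=
  existsb absurd_row l ||
  match fuel with
  | O => false
  | S fuel =>
      let k := cheapest ks l in
      refute fuel (remove Nat.eq_dec k ks) (eliminate k l)
  end.

Lemma dedupe_incl l : incl (dedupe l) l.
Proof.
  induction l as [|p l IH]; simpl; [apply incl_refl |].
  destruct (_ || _)%bool; [now apply incl_tl |].
  intros x [<-|Hx]; simpl; auto.
Qed.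

Lemma dot_zeros v : forall c, forallb (Nat.eqb 0) c = true -> dot c v = 0.
Proof.
  induction v; intros [|b c]; simpl; auto; intros H.
  apply andb_prop in H as [H1 H2]; destruct b; [| discriminate].
  rewrite IHv; auto; simpl; ring.
Qed.

Lemma leq_0_dot c v : leq 0 (dot c v).
Proof. exists (dot c v); ring. Qed.

Lemma holds_eliminate v k l :
  (forall p, In p l -> holds v p) -> forall p, In p (eliminate k l) -> holds v p.
Proof.
  intros Hl p Hp; apply dedupe_incl, in_app_or in Hp as [Hp|Hp].
  - apply in_flat_map in Hp as (q & Hq & Hp); apply in_map_iff in Hp as (r & <- & Hr).
    apply filter_In in Hq as [Hq _]; destruct Hr as [<-|Hr].
    + apply holds_combine; auto; apply leq_0_dot.
    + apply filter_In in Hr as [Hr _]; apply holds_combine; auto.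
  - apply filter_In in Hp as [Hp _]; auto.
Qed.

Lemma refute_sound v fuel : forall ks l,
  refute fuel ks l = true -> (forall p, In p l -> holds (1 :: v) p) -> False.
Proof.
  induction fuel; simpl; intros ks l H Hl; apply Bool.orb_prop in H as [H|H];
    try discriminate.
  1,2: apply existsb_exists in H as ([L R] & Hp & H);
    apply andb_prop in H as [H1 H2]; specialize (Hl _ Hp);
    destruct L as [|[|a] L]; simpl in *; try discriminate; clear H1 Hp;
    destruct Hl as [d E]; simpl fst in E; simpl snd in E;
    rewrite dot_zeros in E by auto; simpl in E;
    apply (num_succ_neq0 (nmul a 1 + dot L v + d)); rewrite E; ring.
  eapply IHfuel; [apply H |]; now apply holds_eliminate.
Qed.

Inductive lexp : Type :=
| LConst (n : nat)
| LVar (k : nat)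
| LAdd (a b : lexp).

Fixpoint lev (v : list N) (a : lexp) : N :=
  match a with
  | LConst O => 0
  | LConst 1 => 1
  | LConst n => nmul n 1
  | LVar k => nth k v 0
  | LAdd a b => lev v a + lev v b
  end.

Fixpoint coeffs (a : lexp) : list nat :=
  match a with
  | LConst n => [n]
  | LVar k => unit_var (S k)
  | LAdd a b => padd (coeffs a) (coeffs b)
  end.

Lemma dot_unit_var v : forall k, dot (unit_var k) v = nth k v 0.
Proof.
  induction v; intros [|k]; simpl; auto; try ring.
  fold (unit_var k); rewrite IHv; ring.
Qed.

Lemma lev_dot v a : lev v a = dot (coeffs a) (1 :: v).
Proof.
  induction a as [[|[|n]]| |]; cbn [lev coeffs].
  - simpl; ring.
  - simpl; ring.
  - simpl; ring.
  - now rewrite dot_unit_var.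
  - now rewrite dot_padd, IHa1, IHa2.
Qed.

(** The hypotheses are premises of an implication, so that a goal is brought into
    this form by reverting them. *)
Fixpoint chain (v : list N) (l : list (lexp * lexp)) : Prop :=
  match l with
  | [] => False
  | (a, b) :: l => leq (lev v a) (lev v b) -> chain v l
  end.

Definition rows (l : list (lexp * lexp)) : list row :=
  map (fun p => cancel (coeffs (fst p)) (coeffs (snd p))) l.

Lemma linear_refutation v l :
  refute (length v) (seq 1 (length v)) (rows l) = true -> chain v l.
Proof.
  intros H.
  assert (G : (forall p, In p l -> leq (lev v (fst p)) (lev v (snd p))) -> False).
  { intros G; apply (refute_sound v _ _ _ H); intros p Hp.
    apply in_map_iff in Hp as (q & <- & Hq).
    apply holds_cancel; rewrite <- !lev_dot; auto. }
  clear H; revert G; induction l as [|[a b] l IH]; simpl; intros G.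
  - apply G; intros p [].
  - intros Hab; apply IH; intros Hl; apply G; intros p [<-|Hp]; auto.
Qed.

Ltac lin_const t :=
  lazymatch t with
  | 0 => constr:(O)
  | 1 => constr:(1%nat)
  | ?a + ?b => let x := lin_const a in let y := lin_const b in
               eval compute in (x + y)%nat
  end.

Ltac lin_index x v :=
  lazymatch v with
  | x :: _ => constr:(O)
  | _ :: ?w => let n := lin_index x w in constr:(S n)
  end.

Ltac lin_insert x v :=
  match constr:(tt) with
  | _ => let _ := lin_index x v in v
  | _ => constr:(x :: v)
  end.

Ltac lin_atoms t v :=
  match t with
  | _ => let _ := lin_const t in v
  | ?a + ?b => let v := lin_atoms a v in lin_atoms b v
  | _ => lin_insert t v
  end.

Ltac lin_reify t v :=
  match t with
  | 0 => constr:(LConst 0)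
  | 1 => constr:(LConst 1)
  | ?a + ?b => let x := lin_reify a v in let y := lin_reify b v in
               constr:(LAdd x y)
  | _ => let n := lin_index t v in constr:(LVar n)
  end.

Ltac lin_rows v l :=
  match goal with
  | H : leq ?a ?b |- _ =>
      let x := lin_reify a v in let y := lin_reify b v in
      revert H; lin_rows v constr:((x, y) :: l)
  | _ => apply (linear_refutation v l); vm_compute; reflexivity
  end.

Ltac lin_vars v :=
  match goal with
  | H : leq ?a ?b |- _ =>
      let v := lin_atoms a v in let v := lin_atoms b v in
      revert H; lin_vars v
  | _ => intros; lin_rows v constr:(@nil (lexp * lexp))
  end.

Ltac lin_hyps :=
  repeat match goal with
  | H : _ /\ _ |- _ => destruct H
  | H : @eq (num M) _ _ |- _ => apply eq_leq in H; destruct H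
  | H : ~ _ < _ |- _ => apply num_not_lt in H
  | H : _ < _ |- _ => apply lt_leq in H
  end.

Ltac lin :=
  intros;
  lazymatch goal with
  | |- False => lin_hyps; lin_vars constr:(@nil N)
  | |- ?x < ?y =>
      let H := fresh in
      destruct (num_lt_or_le x y) as [H|H]; [exact H | exfalso; lin]
  | |- @eq (num M) _ _ => apply num_le_antisym; lin
  | |- ~ _ => let H := fresh in intro H; lin
  | |- _ /\ _ => split; lin
  | _ => exfalso; lin
  end.

Lemma le_diff x y : x <= y <-> exists d, y = x + d.
Proof.
  split.
  - intros H; apply num_lt_diff in H as [d E]; exists d.
    apply num_succ_inj; rewrite E; ring.
  - intros [d ->]; lin.
Qed.

Lemma le_square x : x <= x * x.
Proof.
  destruct (num_case x) as [->|[y ->]].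
  - replace (0 * 0) with 0 by ring; lin.
  - replace ((y + 1) * (y + 1)) with (y * y + y + y + 1) by ring; lin.
Qed.

Lemma le_mul x m : 0 < m -> x <= x * m.
Proof.
  intros H; destruct (num_case m) as [->|[c ->]]; [lin |].
  replace (x * (c + 1)) with (x * c + x) by ring; lin.
Qed.

Lemma mul_pos x y : 0 < x -> 0 < y -> 0 < x * y.
Proof. intros Hx Hy; pose proof (le_mul x y Hy); lin. Qed.

Lemma square_lt x y : x < y -> x * x + x + x < y * y.
Proof.
  intros H; apply num_lt_diff in H as [d ->].
  replace ((x + d + 1) * (x + d + 1))
    with (x * x + x + x + 1 + (d * d + x * d + x * d + d + d)) by ring; lin.
Qed.

(** Numbers between consecutive squares; both the pairing function and the
    layout of the path in the system rest on it. *)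
Lemma square_decomp s t x y :
  s * s + x = t * t + y -> x <= s + s -> y <= t + t -> s = t /\ x = y.
Proof.
  intros E Hx Hy; destruct (num_lt_trichotomy s t) as [H|[->|H]];
    [apply square_lt in H | | apply square_lt in H]; lin.
Qed.

Lemma num_division m a : 0 < m -> exists q v, v < m /\ a = q * m + v.
Proof.
  intros Hm.
  assert (H : exists q, exists v, v < m /\ a = q * m + v); [| exact H].
  revert a; refine (Sigma1_induction _ _ _ _); cbn beta; [delta0 | |].
  - exists 0, 0; split; [exact Hm | ring].
  - intros a (q & v & Hv & E); subst a.
    destruct (num_lt_or_le m (v + 1 + 1)) as [H|H].
    + exists (q + 1), 0; split; [exact Hm |].
      assert (m = v + 1) as -> by lin; ring.
    + exists q, (v + 1); split; [lin | ring].
Qed.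

Lemma remainder_unique m q q' v v' :
  v < m -> v' < m -> q * m + v = q' * m + v' -> v = v'.
Proof.
  intros Hv Hv' E; destruct (num_lt_trichotomy q q') as [H|[->|H]].
  - apply num_lt_diff in H as [d ->].
    replace ((q + d + 1) * m) with (q * m + d * m + m) in E by ring; lin.
  - lin.
  - apply num_lt_diff in H as [d ->].
    replace ((q' + d + 1) * m) with (q' * m + d * m + m) in E by ring; lin.
Qed.

(** * Consequences of induction *)

(** Substitution of a term for a variable of a bounded predicate, expressed by a
    bounded quantifier over the value of the term. *)
Lemma Delta0_app1 (P : N -> Prop) t :
  Term t -> Delta0 (fun e => P (e 0%nat)) -> Delta0 (fun e => P (t e)).
Proof.
  intros Ht HP.
  apply Delta0_ext with (fun e => exists x, x < t e + 1 /\ (x = t e /\ P x)).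
  - intros e; split; [intros (x & _ & E & H); now subst x |].
    intros H; exists (t e); repeat split; auto; lin.
  - apply (Delta0_bex (fun e => t e + 1) (fun e x => x = t e /\ P x)).
    + apply Term_add; [exact Ht | apply Term_const].
    + apply (Delta0_and (fun e => e O = t (fun n => e (S n))) (fun e => P (e O)));
        auto; apply Delta0_eq; [apply Term_var | now apply Term_shift].
Qed.

Lemma Delta0_app2 (P : N -> N -> Prop) t u :
  Term t -> Term u -> Delta0 (fun e => P (e 1%nat) (e 0%nat)) ->
  Delta0 (fun e => P (t e) (u e)).
Proof.
  intros Ht Hu HP.
  apply Delta0_ext with (fun e => exists x, x < t e + 1 /\
    (x = t e /\ exists y, y < u e + 1 /\ (y = u e /\ P x y))).
  - intros e; split; [intros (x & _ & E & y & _ & F & H); now subst x y |].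
    intros H; exists (t e); repeat split; [lin |].
    exists (u e); repeat split; auto; lin.
  - apply (Delta0_bex (fun e => t e + 1) (fun e x => x = t e /\
        exists y, y < u e + 1 /\ (y = u e /\ P x y))).
    { apply Term_add; [exact Ht | apply Term_const]. }
    apply (Delta0_and (fun e => e O = t (fun n => e (S n))) (fun e =>
        exists y, y < u (fun n => e (S n)) + 1 /\
          (y = u (fun n => e (S n)) /\ P (e O) y))).
    { apply Delta0_eq; [apply Term_var | now apply Term_shift]. }
    apply (Delta0_bex (fun e => u (fun n => e (S n)) + 1)
        (fun e y => y = u (fun n => e (S n)) /\ P (e O) y)).
    { apply Term_add; [now apply Term_shift | apply Term_const]. }
    apply (Delta0_and (fun e => e O = u (fun n => e (S (S n))))
        (fun e => P (e 1%nat) (e O))); auto.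
    apply Delta0_eq; [apply Term_var |].
    apply (Term_shift (fun e => u (fun n => e (S n)))); now apply Term_shift.
Qed.

Ltac delta0_context :=
  match goal with
  | |- Term (fun e => ?t (fun n => e (S (@?f n)))) =>
      apply (Term_shift (fun e => t (fun n => e (f n))))
  | H : Term ?t |- Term (fun e => ?t _) => exact H
  | H : Term ?t |- Term ?t => exact H
  | H : Delta0 (fun e => ?P (e O)) |- Delta0 (fun e => ?P (@?t e)) =>
      apply (Delta0_app1 P t); [| exact H]
  | H : Delta0 (fun e => ?P (e 1%nat) (e O))
    |- Delta0 (fun e => ?P (@?t e) (@?u e)) =>
      apply (Delta0_app2 P t u); [| | exact H]
  end.
Ltac delta0_atom ::= delta0_context.

Theorem Delta0_comprehension (P : N -> Prop) :
  Delta0 (fun e => P (e 0%nat)) -> exists X, forall x, x ∈ X <-> P x.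
Proof.
  intros HP.
  destruct (Delta1_comprehension (fun x _ => P x) (fun x _ => P x)) as [X HX];
    try delta0.
  - intros x; split; [intros [_ H] _; auto | intros H; exists 0; apply H; exact 0].
  - exists X; intros x; rewrite HX; split; [now intros [_ H] | now exists 0].
Qed.

Theorem least_number (P : N -> Prop) :
  Delta0 (fun e => P (e 0%nat)) -> (exists x, P x) ->
  exists x, P x /\ forall y, y < x -> ~ P y.
Proof.
  intros HP [x Hx]; apply NNPP; intros HN.
  assert (H : forall n y, y < n -> ~ P y).
  { intros n; induct n.
    - intros y Hy; lin.
    - intros n IH y Hy Py; apply HN; exists y; split; auto.
      intros z Hz; apply IH; lin. }
  apply (H (x + 1) x); auto; lin.
Qed.

(** The bound for [k] instances and a witness for the next add up to a bound for
    [k + 1]; the induction is existential because the bound is what varies. *)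
Theorem collection (P : N -> N -> Prop) n :
  Delta0 (fun e => P (e 1%nat) (e 0%nat)) -> (forall i, i < n -> exists y, P i y) ->
  exists B, forall i, i < n -> exists y, y < B /\ P i y.
Proof.
  intros HP HE.
  assert (H : forall k, exists B, k <= n -> forall i, i < k -> exists y, y < B /\ P i y).
  { refine (Sigma1_induction _ _ _ _); cbn beta; [delta0 | |].
    - exists 0; intros _ i Hi; lin.
    - intros k [B HB].
      destruct (num_lt_or_le k n) as [Hk|Hk]; [| exists 0; intros H; lin].
      destruct (HE k Hk) as [y Hy]; exists (B + y + 1); intros _ i Hi.
      apply num_lt_succ in Hi as [Hi| ->].
      + destruct (HB ltac:(lin) i Hi) as (x & Hx & Px); exists x; split; auto; lin.
      + exists y; split; auto; lin. }
  destruct (H n) as [B HB]; exists B; apply HB; lin.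
Qed.

(** * Codes of finite sequences *)

(** This and the other relations that appear in the principles repeat the formulas
    of the language quantifier by quantifier, so that the truth of such a formula
    is convertible to the corresponding relation. *)
Definition pr (x y : N) : N := (x + y) * (x + y) + x.

Definition len (s l : N) : Prop :=
  exists a, a < s + 1 /\ exists b, b < s + 1 /\ s = pr l (pr a b).

Definition entry (s i v : N) : Prop :=
  exists l, l < s + 1 /\ exists a, a < s + 1 /\ exists b, b < s + 1 /\
    (s = pr l (pr a b) /\ i < l /\ v < b * (i + 1) + 1 /\
     exists q, q < a + 1 /\ a = q * (b * (i + 1) + 1) + v).

Definition same_seq (s t : N) : Prop :=
  exists l, l < s + 1 /\ (len s l /\ len t l /\
    forall i, i < l -> exists v, v < s + 1 /\ (entry s i v /\ entry t i v)).

Definition sequence (s : N) : Prop :=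
  (exists l, l < s + 1 /\ len s l) /\ forall t, t < s -> ~ same_seq s t.

Definition string (s : N) : Prop :=
  sequence s /\ forall i, i < s + 1 -> forall v, v < s + 1 ->
    entry s i v -> (v = 0 \/ v = 1).

Definition prefix (s t : N) : Prop :=
  exists k, k < s + 1 /\ exists l, l < t + 1 /\ (len s k /\ len t l /\ k <= l /\
    forall i, i < k -> exists v, v < s + 1 /\ (entry s i v /\ entry t i v)).

Definition restriction (X : set M) (n s : N) : Prop :=
  string s /\ len s n /\ forall i, i < n -> (entry s i 1 <-> i ∈ X).

Lemma Term_pr t u : Term t -> Term u -> Term (fun e => pr (t e) (u e)).
Proof.
  intros Ht Hu; unfold pr; repeat first [apply Term_add | apply Term_mul]; auto.
Qed.

Ltac delta0_pr :=
  match goal with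
  | |- Term (fun e => pr (@?t e) (@?u e)) => apply (Term_pr t u)
  | _ => delta0_context
  end.
Ltac delta0_atom ::= delta0_pr.

Lemma Delta0_len t u : Term t -> Term u -> Delta0 (fun e => len (t e) (u e)).
Proof. intros Ht Hu; unfold len; delta0. Qed.

Lemma Delta0_entry t u v :
  Term t -> Term u -> Term v -> Delta0 (fun e => entry (t e) (u e) (v e)).
Proof. intros Ht Hu Hv; unfold entry; delta0. Qed.

Ltac delta0_code :=
  match goal with
  | |- Delta0 (fun e => len (@?t e) (@?u e)) => apply (Delta0_len t u)
  | |- Delta0 (fun e => entry (@?t e) (@?u e) (@?v e)) => apply (Delta0_entry t u v)
  | _ => delta0_pr
  end.
Ltac delta0_atom ::= delta0_code.

Lemma Delta0_same_seq t u :
  Term t -> Term u -> Delta0 (fun e => same_seq (t e) (u e)).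
Proof. intros Ht Hu; unfold same_seq; delta0. Qed.

Ltac delta0_seq :=
  match goal with
  | |- Delta0 (fun e => same_seq (@?t e) (@?u e)) => apply (Delta0_same_seq t u)
  | _ => delta0_code
  end.
Ltac delta0_atom ::= delta0_seq.

Lemma Delta0_string t : Term t -> Delta0 (fun e => string (t e)).
Proof. intros Ht; unfold string, sequence; delta0. Qed.

Ltac delta0_string :=
  match goal with
  | |- Delta0 (fun e => string (@?t e)) => apply (Delta0_string t)
  | _ => delta0_seq
  end.
Ltac delta0_atom ::= delta0_string.

Lemma le_pr_l x y : x <= pr x y.
Proof. unfold pr; lin. Qed.

Lemma le_pr_r x y : y <= pr x y.
Proof. unfold pr; pose proof (le_square (x + y)); lin. Qed.

Lemma pr_inj x y x' y' : pr x y = pr x' y' -> x = x' /\ y = y'.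
Proof.
  unfold pr; intros E.
  destruct (square_decomp (x + y) (x' + y') x x' E); lin.
Qed.

Lemma pr_mono x y x' y' : x <= x' -> y <= y' -> pr x y <= pr x' y'.
Proof.
  intros Hx Hy; apply le_diff in Hx as [c ->], Hy as [d ->]; apply le_diff.
  exists ((c + d) * (x + y + (x + y) + c + d) + c); unfold pr; ring.
Qed.

Definition modulus (b i : N) : N := b * (i + 1) + 1.

Lemma len_code l a b l' : len (pr l (pr a b)) l' <-> l' = l.
Proof.
  split.
  - intros (a' & _ & b' & _ & E); symmetry; now apply pr_inj in E.
  - intros ->; pose proof (le_pr_r l (pr a b)).
    exists a; split; [pose proof (le_pr_l a b); lin |].
    exists b; split; [pose proof (le_pr_r a b); lin | auto].
Qed.

Lemma entry_code l a b i v : entry (pr l (pr a b)) i v <->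
  i < l /\ v < modulus b i /\ exists q, a = q * modulus b i + v.
Proof.
  unfold modulus; split.
  - intros (l' & _ & a' & _ & b' & _ & E & Hi & Hv & q & _ & Hq).
    apply pr_inj in E as [<- E]; apply pr_inj in E as [<- <-]; eauto.
  - intros (Hi & Hv & q & Hq); pose proof (le_pr_r l (pr a b)).
    exists l; split; [apply le_pr_l |].
    exists a; split; [pose proof (le_pr_l a b); lin |].
    exists b; split; [pose proof (le_pr_r a b); lin |].
    repeat split; auto; exists q; split; auto.
    pose proof (le_mul q (b * (i + 1) + 1) ltac:(lin)); lin.
Qed.

Lemma len_elim s l : len s l -> exists a b, s = pr l (pr a b).
Proof. intros (a & _ & b & _ & E); eauto. Qed.

Lemma entry_elim s i v : entry s i v -> exists l a b, s = pr l (pr a b).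
Proof. intros (l & _ & a & _ & b & _ & E & _); eauto. Qed.

Lemma len_fun s l l' : len s l -> len s l' -> l = l'.
Proof. intros (a & b & ->)%len_elim H; now apply len_code in H. Qed.

Lemma len_le s l : len s l -> l <= s.
Proof. intros (a & b & ->)%len_elim; apply le_pr_l. Qed.

Lemma entry_fun s i v v' : entry s i v -> entry s i v' -> v = v'.
Proof.
  intros H H'; destruct (entry_elim _ _ _ H) as (l & a & b & ->).
  apply entry_code in H as (_ & Hv & q & Hq), H' as (_ & Hv' & q' & Hq').
  apply (remainder_unique (modulus b i) q q'); congruence.
Qed.

Lemma entry_lt s i v l : entry s i v -> len s l -> i < l.
Proof.
  intros H (a & b & ->)%len_elim; now apply entry_code in H as [Hi _].
Qed.

Lemma entry_total s i l : len s l -> i < l -> exists v, entry s i v.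
Proof.
  intros (a & b & ->)%len_elim Hi.
  destruct (num_division (modulus b i) a) as (q & v & Hv & E);
    [unfold modulus; lin |].
  exists v; apply entry_code; eauto.
Qed.

Lemma entry_le s i v : entry s i v -> i <= s /\ v <= s.
Proof.
  intros H; destruct (entry_elim _ _ _ H) as (l & a & b & ->).
  apply entry_code in H as (Hi & Hv & q & ->).
  set (m := modulus b i) in *.
  pose proof (le_pr_l l (pr (q * m + v) b)).
  pose proof (le_pr_r l (pr (q * m + v) b)).
  pose proof (le_pr_l (q * m + v) b); lin.
Qed.

Definition agree (n s t : N) : Prop :=
  forall i, i < n -> forall v, entry s i v <-> entry t i v.

Lemma agree_entries n s t l k : len s l -> len t k -> n <= l -> n <= k ->
  (agree n s t <->
   forall i, i < n -> exists v, v < s + 1 /\ (entry s i v /\ entry t i v)).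
Proof.
  intros Hs Ht Hl Hk; split.
  - intros H i Hi; destruct (entry_total s i l Hs) as [v Hv]; [lin |].
    exists v; split; [apply (entry_le s i v Hv) |].
    split; auto; now apply H.
  - intros H i Hi v; destruct (H i Hi) as (w & _ & Hw & Hw').
    split; intros Hv.
    + now rewrite (entry_fun _ _ _ _ Hv Hw).
    + now rewrite (entry_fun _ _ _ _ Hv Hw').
Qed.

Lemma same_seq_iff s t l : len s l ->
  (same_seq s t <-> len t l /\ agree l s t).
Proof.
  intros Hl; split.
  - intros (k & _ & Hk & Ht & H); rewrite (len_fun _ _ _ Hl Hk); split; auto.
    apply (agree_entries k s t k k); auto; lin.
  - intros [Ht H]; exists l; split; [now apply len_le |].
    repeat split; auto; apply (agree_entries l s t l l); auto; lin.
Qed.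

Lemma agree_sym n s t : agree n s t -> agree n t s.
Proof. intros H i Hi v; symmetry; now apply H. Qed.

(** * Binary strings *)

Lemma string_len s : string s -> exists l, len s l.
Proof. intros [[(l & _ & H) _] _]; eauto. Qed.

Lemma string_entry s i v : string s -> entry s i v -> v = 0 \/ v = 1.
Proof. intros [_ H] E; destruct (entry_le s i v E); eauto. Qed.

Definition bit (s i : N) : Prop := entry s i 1.

Lemma Delta0_bit t u : Term t -> Term u -> Delta0 (fun e => bit (t e) (u e)).
Proof. intros Ht Hu; unfold bit; delta0. Qed.

Lemma num_0_neq_1 : 0 <> 1.
Proof. intros H; apply (num_succ_neq0 0); rewrite H at 2; ring. Qed.

Lemma string_bits_agree s t l k n : string s -> string t ->
  len s l -> len t k -> n <= l -> n <= k ->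
  (forall i, i < n -> (bit s i <-> bit t i)) -> agree n s t.
Proof.
  intros Ss St Hs Ht Hl Hk H i Hi.
  destruct (entry_total s i l Hs) as [v Hv]; [lin |].
  destruct (entry_total t i k Ht) as [w Hw]; [lin |].
  assert (v = w).
  { destruct (string_entry _ _ _ Ss Hv) as [-> | ->],
      (string_entry _ _ _ St Hw) as [-> | ->]; auto.
    - apply H in Hw; auto; exact (entry_fun _ _ _ _ Hv Hw).
    - apply H in Hv; auto; exact (entry_fun _ _ _ _ Hv Hw). }
  subst w; intros u; split; intros Hu.
  - now rewrite (entry_fun _ _ _ _ Hu Hv).
  - now rewrite (entry_fun _ _ _ _ Hu Hw).
Qed.

(** A sequence has one code only, as codes are least among their equivalents. *)
Lemma string_ext s t l : string s -> string t -> len s l -> len t l ->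
  (forall i, i < l -> (bit s i <-> bit t i)) -> s = t.
Proof.
  intros Ss St Hs Ht H.
  assert (A : agree l s t) by (apply (string_bits_agree s t l l); auto; lin).
  destruct Ss as [[_ Ms] _], St as [[_ Mt] _].
  destruct (num_lt_trichotomy s t) as [L|[E|L]]; auto; exfalso.
  - apply (Mt s L), (same_seq_iff t s l); auto using agree_sym.
  - apply (Ms t L), (same_seq_iff s t l); auto.
Qed.

(** The least equivalent of a code is itself least among its equivalents. *)
Lemma string_of_code c l : len c l ->
  (forall i v, entry c i v -> v = 0 \/ v = 1) ->
  exists s, s <= c /\ string s /\ len s l /\ forall i, i < l -> (bit s i <-> bit c i).
Proof.
  intros Hc Hv.
  destruct (least_number (fun s => same_seq c s)) as (s & Hs & Hmin).
  - delta0.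
  - exists c; apply (same_seq_iff c c l); auto; split; auto; now intros i Hi v.
  - apply (same_seq_iff c s l) in Hs as [Hs A]; auto.
    exists s; repeat split; auto; try (now apply A).
    + apply num_not_lt; intros L; apply (Hmin c L), (same_seq_iff c c l); auto.
      split; auto; now intros i Hi v.
    + exists l; split; auto; now apply len_le.
    + intros t Lt Ht; apply (same_seq_iff s t l) in Ht as [Ht B]; auto.
      apply (Hmin t Lt), (same_seq_iff c t l); auto; split; auto.
      intros i Hi v; now rewrite (A i Hi v), (B i Hi v).
    + intros i _ v _ E; apply (Hv i); apply A; auto.
      eapply entry_lt; eauto.
Qed.

(** * Gödel's beta function *)

Lemma common_multiple n : exists b, 0 < b /\
  forall e, e < n -> exists g, g < b + 1 /\ b = (e + 1) * g.
Proof.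
  revert n; refine (Sigma1_induction _ _ _ _); cbn beta; [delta0 | |].
  - exists 1; split; [lin | intros e He; lin].
  - intros n (b & Hb & H); exists (b * (n + 1)); split.
    + apply mul_pos; auto; lin.
    + intros e He; apply num_lt_succ in He as [He| ->].
      * destruct (H e He) as (g & Hg & E); exists (g * (n + 1)); split.
        -- rewrite E; pose proof (le_mul (g * (n + 1)) (e + 1) ltac:(lin)).
           replace ((e + 1) * g * (n + 1)) with (g * (n + 1) * (e + 1)) by ring; lin.
        -- rewrite E; ring.
      * exists b; split; [| ring].
        pose proof (le_mul b (n + 1) ltac:(lin)); lin.
Qed.

(** A congruence modulo [m] between [x] and 1 puts multiples of [m] on both
    sides; those next to [x] can be moved across, since [x] is not negative and
    1 is less than [m]. *)
Lemma mod_cancel x m p q : 1 < m -> x + m * p = 1 + m * q -> exists k, x = 1 + m * k.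
Proof.
  intros Hm E; destruct (num_lt_or_le q p) as [H|H].
  - apply num_lt_diff in H as [d ->].
    replace (m * (q + d + 1)) with (m * q + m * d + m) in E by ring; lin.
  - apply le_diff in H as [k ->]; exists k.
    apply (num_add_cancel _ _ (m * p)); rewrite E; ring.
Qed.

(** With [J = j + 1] and [p = b * J] the modulus of [j] is [p + 1], and the
    hypothesis on [b] turns [J * J * g] into minus an inverse of the modulus of
    [n]; multiplying by [p], which is minus one, corrects the sign. *)
Lemma modulus_inverse b n e g : 0 < b -> b = (e + 1) * g ->
  exists y k, modulus b n * y = 1 + k * modulus b (n + e + 1).
Proof.
  intros Hb Hg; set (J := n + e + 1 + 1); set (p := b * J); set (y := J * J * g).
  assert (Em : modulus b (n + e + 1) = p + 1) by reflexivity.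
  assert (E : modulus b n * y + p * p = (p + 1) * y).
  { replace (p * p) with (b * (J * J) * b) by (unfold p; ring).
    rewrite Hg at 3; unfold p, y, modulus, J; ring. }
  assert (Hp : 0 < p) by (apply mul_pos; auto; unfold J; lin).
  destruct (mod_cancel (modulus b n * (y * p)) (p + 1) (p * p + 1) (y * p + p))
    as [k Hk]; [lin | |].
  - transitivity ((modulus b n * y + p * p) * p + 1 + p * (p + 1)); [ring |].
    rewrite E; ring.
  - exists (y * p), k; rewrite Hk, Em; ring.
Qed.

Definition residue (X : set M) (b a i : N) : Prop :=
  exists q, q < a + 1 /\
    ((i ∈ X /\ a = q * modulus b i + 1) \/ (~ i ∈ X /\ a = q * modulus b i)).

Definition invertible (K m z : N) : Prop :=
  exists u, u < z /\ exists w, w < z /\ K * u = 1 + w * m.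

(** The remainders are corrected one at a time; [K] is the product of the
    moduli met so far, and it stays invertible modulo the ones to come. *)
Lemma beta (X : set M) b L : 0 < b ->
  (forall e, e < L -> exists g, g < b + 1 /\ b = (e + 1) * g) ->
  exists a K, 0 < K /\
    (forall i, i < L -> residue X b a i) /\
    (forall i, i < L -> exists k, k < K + 1 /\ K = k * modulus b i).
Proof.
  intros Hb Hdiv.
  assert (Hm : forall i, 0 < modulus b i) by (intros i; unfold modulus; lin).
  assert (H : forall n, exists z, n <= L -> exists a, a < z /\ exists K, K < z /\
    (0 < K /\ (forall i, i < n -> residue X b a i) /\
    (forall i, i < n -> exists k, k < K + 1 /\ K = k * modulus b i) /\
    forall j, j < L -> n <= j -> invertible K (modulus b j) z)).
  { refine (Sigma1_induction _ _ _ _); cbn beta.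
    - unfold residue, invertible, modulus; delta0.
    - exists (1 + 1); intros _; exists 0; split; [lin |]; exists 1.
      repeat split; try lin.
      intros j _ _; exists 1; split; [lin |]; exists 0; split; [lin | ring].
    - intros n (z & Hz); destruct (num_lt_or_le L (n + 1)) as [HL|HL].
      { exists 0; intros H; lin. }
      destruct Hz as (a & Ha & K & HK & K0 & Hres & HdivK & Hinv); [lin |].
      set (m := modulus b n).
      destruct (Hinv n) as (u & Hu & w & Hw & Euw); [lin | lin |].
      assert (Hc : exists c, (n ∈ X /\ c = 1) \/ (~ n ∈ X /\ c = 0)).
      { destruct (classic (n ∈ X)); eauto. }
      destruct Hc as [c Hc].
      (* [u] inverts [K] and [b * (n + 1)] is minus one modulo [m], so adding
         [t * K] turns the remainder of [a] into [c] and spares the others. *)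
      set (t := u * (c + b * (n + 1) * a)).
      assert (Ea : a + t * K = (a + w * (c + b * (n + 1) * a)) * m + c).
      { replace (t * K) with (K * u * (c + b * (n + 1) * a)) by (unfold t; ring).
        rewrite Euw; unfold m, modulus; ring. }
      (* The inverses for the product [K * m] need a common bound, as the
         invariant has to be an existential statement about one number. *)
      destruct (collection (fun j y => n + 1 <= j ->
          invertible (K * m) (modulus b j) y) L) as [B HB].
      + unfold invertible, modulus; delta0.
      + intros j Hj; destruct (num_lt_or_le n j) as [Hnj|Hnj];
          [| exists 0; intros H; lin].
        destruct (Hinv j) as (u' & Hu' & w' & Hw' & E'); [lin | lin |].
        apply num_lt_diff in Hnj as [e ->].
        destruct (Hdiv e) as (g & _ & Hg); [lin |].
        destruct (modulus_inverse b n e g Hb Hg) as (y & k & Ey); fold m in Ey.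
        set (mj := modulus b (n + e + 1)) in *.
        exists (u' * y + (k + w' + w' * mj * k) + 1); intros _.
        exists (u' * y); split; [lin |].
        exists (k + w' + w' * mj * k); split; [lin |].
        transitivity (K * u' * (m * y)); [ring |]; rewrite E', Ey; ring.
      + exists (a + t * K + K * m + B + 1); intros _.
        exists (a + t * K); split; [lin |]; exists (K * m); split; [lin |].
        split; [exact (mul_pos K m K0 (Hm n)) |]; repeat split.
        * intros i Hi; apply num_lt_succ in Hi as [Hi| ->].
          -- destruct (Hres i Hi) as (q & _ & Hq).
             destruct (HdivK i Hi) as (k & _ & Hk).
             exists (q + t * k).
             assert (E : t * K = t * k * modulus b i) by (rewrite Hk at 1; ring).
             assert (F : (q + t * k) * modulus b i = q * modulus b i + t * K)
               by (rewrite E; ring).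
             pose proof (le_mul (q + t * k) (modulus b i) (Hm i)).
             rewrite F in *; split.
             ++ destruct Hq as [[_ E1]|[_ E1]]; lin.
             ++ destruct Hq as [[I E1]|[I E1]]; [left | right]; split; auto; lin.
          -- exists (a + w * (c + b * (n + 1) * a)); rewrite Ea; fold m; split.
             ++ pose proof (le_mul (a + w * (c + b * (n + 1) * a)) m (Hm n)); lin.
             ++ destruct Hc as [[I ->]|[I ->]]; [left | right]; split; auto; ring.
        * intros i Hi; apply num_lt_succ in Hi as [Hi| ->].
          -- destruct (HdivK i Hi) as (k & _ & Hk); exists (k * m).
             assert (E : K * m = k * m * modulus b i) by (rewrite Hk at 1; ring).
             split; auto; rewrite E; exact (le_mul _ _ (Hm i)).
          -- exists K; split; auto; exact (le_mul K m (Hm n)).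
        * intros j Hj Hnj; destruct (HB j Hj) as (y & Hy & Hinv').
          destruct (Hinv' Hnj) as (u' & Hu' & w' & Hw' & E').
          exists u'; split; [lin |]; exists w'; split; [lin | exact E']. }
  destruct (H L) as [z Hz]; destruct Hz as (a & _ & K & _ & HK & Hr & Hd & _);
    [lin |].
  exists a, K; auto.
Qed.

(** Reducing [a] modulo the product of the moduli bounds the code by a number
    that depends on the length alone. *)
Theorem restriction_bounded n : exists B, forall X l, l <= n ->
  exists s, s < B /\ restriction X l s.
Proof.
  destruct (common_multiple n) as (b & Hb & Hdiv).
  destruct (beta (some_set M) b n Hb Hdiv) as (_ & K & HK & _ & HdivK).
  exists (pr n (pr K b) + 1); intros X l Hl.
  destruct (beta X b n Hb Hdiv) as (a & _ & _ & Hres & _).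
  destruct (num_division K a HK) as (Q & a0 & Ha0 & Ea).
  assert (Hmod : forall i, 1 < modulus b i).
  { intros i; pose proof (mul_pos b (i + 1) Hb ltac:(lin)); unfold modulus; lin. }
  assert (HE : forall i, i < l ->
    ((i ∈ X /\ entry (pr l (pr a0 b)) i 1) \/
     (~ i ∈ X /\ entry (pr l (pr a0 b)) i 0))).
  { intros i Hi; specialize (Hmod i).
    destruct (HdivK i) as (k & _ & Hk); [lin |].
    destruct (num_division (modulus b i) a0) as (q & v & Hv & E); [lin |].
    assert (F : a = (q + Q * k) * modulus b i + v)
      by (rewrite Ea, E, Hk; ring).
    destruct (Hres i) as (q' & _ & [[I G]|[I G]]); [lin | left | right];
      (split; [exact I |]); apply entry_code;
      (split; [exact Hi | split; [lin | exists q; rewrite E; f_equal]]).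
    - apply (remainder_unique (modulus b i) (q + Q * k) q'); auto.
      rewrite <- F, G; reflexivity.
    - apply (remainder_unique (modulus b i) (q + Q * k) q'); auto; [lin |].
      rewrite <- F, G; ring. }
  destruct (string_of_code (pr l (pr a0 b)) l) as (s & Hs & Ss & Ls & Bs).
  - now apply len_code.
  - intros i v E; assert (Hi : i < l) by (apply entry_code in E; tauto).
    destruct (HE i Hi) as [[_ F]|[_ F]]; rewrite (entry_fun _ _ _ _ E F); auto.
  - exists s; split; [| split; [exact Ss | split; [exact Ls |]]].
    + pose proof (pr_mono l (pr a0 b) n (pr K b) Hl).
      pose proof (pr_mono a0 b K b ltac:(lin) ltac:(lin)).
      assert (pr l (pr a0 b) <= pr n (pr K b)) by auto; lin.
    + intros i Hi; rewrite (Bs i Hi).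
      destruct (HE i Hi) as [[I F]|[I F]]; split; auto; [| tauto].
      intros G; exfalso; apply num_0_neq_1; exact (entry_fun _ _ _ _ F G).
Qed.

Lemma restriction_exists X n : exists s, restriction X n s.
Proof.
  destruct (restriction_bounded n) as [B HB].
  destruct (HB X n ltac:(lin)) as (s & _ & Hs); eauto.
Qed.

Lemma restriction_unique X n s t : restriction X n s -> restriction X n t -> s = t.
Proof.
  intros (Ss & Ls & Hs) (St & Lt & Ht); apply (string_ext s t n); auto.
  intros i Hi; unfold bit; now rewrite Hs, Ht.
Qed.

Ltac delta0_bit :=
  match goal with
  | |- Delta0 (fun e => bit (@?t e) (@?u e)) => apply (Delta0_bit t u)
  | _ => delta0_string
  end.
Ltac delta0_atom ::= delta0_bit.

Theorem string_comprehension (P : N -> Prop) n :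
  Delta0 (fun e => P (e O)) ->
  exists s, string s /\ len s n /\ forall i, i < n -> (bit s i <-> P i).
Proof.
  intros HP; destruct (Delta0_comprehension P HP) as [X HX].
  destruct (restriction_exists X n) as (s & Ss & Ls & Hs).
  exists s; split; [exact Ss | split; [exact Ls |]].
  intros i Hi; unfold bit; now rewrite (Hs i Hi), HX.
Qed.

Lemma string_is_restriction s l : string s -> len s l ->
  exists X, restriction X l s.
Proof.
  intros Ss Ls; destruct (Delta0_comprehension (fun i => bit s i)) as [X HX];
    [delta0 |].
  exists X; split; [exact Ss | split; [exact Ls |]].
  intros i _; symmetry; apply HX.
Qed.

(** This is why an infinite tree has long members: unboundedly many codes cannot
    all belong to short strings. *)
Theorem strings_bounded n : exists B, forall s l,
  string s -> len s l -> l <= n -> s < B.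
Proof.
  destruct (restriction_bounded n) as [B HB]; exists B; intros s l Ss Ls Hl.
  destruct (string_is_restriction s l Ss Ls) as [X HX].
  destruct (HB X l Hl) as (t & Ht & HX').
  now rewrite (restriction_unique X l s t).
Qed.

Lemma prefix_iff s t k l : string s -> string t -> len s k -> len t l ->
  (prefix s t <-> k <= l /\ forall i, i < k -> (bit s i <-> bit t i)).
Proof.
  intros Ss St Hs Ht; split.
  - intros (k' & _ & l' & _ & Hk & Hl & Hle & H).
    rewrite (len_fun _ _ _ Hs Hk), (len_fun _ _ _ Ht Hl); split; auto.
    intros i Hi; apply (agree_entries k' s t k' l') in H; auto; [| lin].
    now apply H.
  - intros [Hle H]; exists k; split; [now apply len_le |].
    exists l; split; [now apply len_le |]; repeat split; auto.
    apply (agree_entries k s t k l); auto; [lin |].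
    apply (string_bits_agree s t k l); auto; lin.
Qed.

Lemma bit_lt s i l : bit s i -> len s l -> i < l.
Proof. apply entry_lt. Qed.

(** * Trees, systems and recurrent points in a model *)

Definition tree (C : set M) : Prop :=
  (forall s, s ∈ C -> string s) /\
  (forall s t, string s /\ t ∈ C /\ prefix s t -> s ∈ C).

Definition path (C X : set M) : Prop :=
  forall n, exists s, restriction X n s /\ s ∈ C.

Definition infinite (X : set M) : Prop := forall m, exists n, m < n /\ n ∈ X.

Definition app (f : set M) (s t : N) : Prop := pr s t ∈ f.

Definition string_function (f : set M) : Prop :=
  (forall z, z ∈ f -> exists s t, z = pr s t /\ string s /\ string t) /\
  (forall s, string s -> exists t, app f s t /\ forall u, app f s u -> u = t).

Definition encodes_transformation (f : set M) : Prop :=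
  string_function f /\
  (forall s t s' t', string s /\ string t /\ prefix s t /\ app f s s' /\ app f t t' ->
     prefix s' t') /\
  (forall l, exists m, forall s, string s /\ len s m ->
     exists t k, app f s t /\ len t k /\ l <= k) /\
  (forall s t m k, string s /\ len s m /\ ~ (m = 0) /\ app f s t /\ len t k -> k < m).

Definition iter (f : set M) (k s t : N) : Prop :=
  exists c, sequence c /\ len c (k + 1) /\ entry c 0 s /\ entry c k t /\
    forall i, i < k -> exists u v, entry c i u /\ entry c (i + 1) v /\ app f u v.

Definition iter_point (f : set M) (k : N) (X Y : set M) : Prop :=
  forall n, exists r, restriction Y n r /\
    exists m, forall l, m <= l ->
      exists s t, restriction X l s /\ iter f k s t /\ prefix r t.

Definition system (C f : set M) : Prop :=
  tree C /\ encodes_transformation f /\ (exists X, path C X) /\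
  (forall s t, s ∈ C /\ app f s t -> t ∈ C).

Definition recurrent_point (C f X : set M) : Prop :=
  path C X /\
  (forall n c, exists k Y, iter_point f (n + k) X Y /\
     exists r, restriction X c r /\ restriction Y c r).

Lemma sat_RP e r : sat M e r RP <->
  forall C f, system C f -> exists X, recurrent_point C f X.
Proof. reflexivity. Qed.

Lemma sat_WKL e r : sat M e r WKL <->
  forall T, tree T /\ infinite T -> exists X, path T X.
Proof. reflexivity. Qed.

(** * The system of a tree *)

Section System.

Variable T : set M.
Hypothesis T_tree : tree T.
Hypothesis T_infinite : infinite T.

(** A symbol occupies two bits.  The datum of a separator is ignored. *)
Definition flag (s i : N) : Prop := bit s (i + i).
Definition datum (s i : N) : Prop := bit s (i + i + 1).

Definition block (s a n r : N) : Prop :=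
  string r /\ len r n /\ forall i, i < n -> (bit r i <-> datum s (a + i)).

Definition block_in (s a n : N) : Prop := exists r, block s a n r /\ r ∈ T.

Lemma block_in_ext s s' a a' n :
  (forall i, i < n -> (datum s (a + i) <-> datum s' (a' + i))) ->
  block_in s a n -> block_in s' a' n.
Proof.
  intros E (r & (Sr & Lr & Hr) & HT); exists r; split; auto; split; auto.
  split; auto; intros i Hi; now rewrite (Hr i Hi), (E i Hi).
Qed.

(** A block determines the string that it spells, so a quantifier over that
    string can be read either way and the comprehension is recursive. *)
Lemma block_in_set : exists D, forall s a n, pr s (pr a n) ∈ D <-> block_in s a n.
Proof.
  destruct (Delta1_comprehension
    (fun z r => exists s, s < z + 1 /\ exists a, a < z + 1 /\ exists n, n < z + 1 /\
       (z = pr s (pr a n) /\ block s a n r /\ r ∈ T))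
    (fun z r => exists s, s < z + 1 /\ exists a, a < z + 1 /\ exists n, n < z + 1 /\
       (z = pr s (pr a n) /\ (block s a n r -> r ∈ T)))) as [D HD].
  - unfold block, datum; delta0.
  - unfold block, datum; delta0.
  - intros z; split.
    + intros (r & s & Hs & a & Ha & n & Hn & E & (Sr & Lr & Br) & HT) r'.
      exists s; split; auto; exists a; split; auto; exists n; repeat split; auto.
      intros (Sr' & Lr' & Br'); rewrite (string_ext r' r n); auto.
      intros i Hi; now rewrite Br', Br.
    + intros H; destruct (H 0) as (s & Hs & a & Ha & n & Hn & E & _).
      destruct (string_comprehension (fun i => datum s (a + i)) n) as (r & Hr).
      { unfold datum; delta0. }
      exists r, s; split; auto; exists a; split; auto; exists n; repeat split;
        auto; try apply Hr; auto.
      destruct (H r) as (s' & _ & a' & _ & n' & _ & E' & HT).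
      rewrite E in E'; apply pr_inj in E' as [<- E']; apply pr_inj in E' as [<- <-].
      now apply HT.
  - exists D; intros s a n; rewrite HD; split.
    + intros (r & s' & _ & a' & _ & n' & _ & E & H).
      apply pr_inj in E as [<- E]; apply pr_inj in E as [<- <-]; now exists r.
    + intros (r & H); exists r, s; split; [apply le_pr_l |].
      pose proof (le_pr_r s (pr a n)).
      exists a; split; [pose proof (le_pr_l a n); lin |].
      exists n; split; [pose proof (le_pr_r a n); lin | auto].
Qed.

(** [start s a] and [clear s a n] make the symbols from [a] to [a + n] an initial
    part of a block. *)
Definition start (s a : N) : Prop :=
  a = 0 \/ exists c, c < a /\ (a = c + 1 /\ flag s c).

Definition clear (s a n : N) : Prop := forall i, i < n -> ~ flag s (a + i).

(** Stated for a predicate, as it applies to the flags of strings and of points. *)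
Definition gap (F : N -> Prop) (p d : N) : Prop :=
  F p /\ F (p + d) /\ 0 < d /\ forall i, i < d -> 0 < i -> ~ F (p + i).

Definition blocks (s l : N) : Prop :=
  forall a n, start s a -> clear s a n -> a + n + (a + n) <= l -> block_in s a n.

(** The reason why gaps increase whenever a block is used up. *)
Definition growth (s : N) : Prop :=
  forall p d, gap (flag s) p d -> forall i, i < d -> ~ flag s (p + d + (i + 1)).

Definition admissible (s : N) : Prop :=
  string s /\ exists l, len s l /\ blocks s l /\ growth s.

Lemma flag_lt s i l : flag s i -> len s l -> i + i < l.
Proof. apply bit_lt. Qed.

Lemma flag_le s i : flag s i -> i + i <= s.
Proof. intros H; now apply entry_le in H. Qed.

Lemma system_tree : exists C, forall s, s ∈ C <-> admissible s.
Proof.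
  destruct block_in_set as [D HD].
  destruct (Delta0_comprehension (fun s => string s /\ exists l, l < s + 1 /\
    (len s l /\
    (forall a, a < s + 1 -> forall n, n < s + 1 ->
      start s a -> clear s a n -> a + n + (a + n) <= l -> pr s (pr a n) ∈ D) /\
    (forall p, p < s + 1 -> forall d, d < s + 1 -> gap (flag s) p d ->
      forall i, i < d -> ~ flag s (p + d + (i + 1)))))) as [C HC].
  - unfold start, clear, gap, flag; delta0.
  - exists C; intros s; rewrite HC; split.
    + intros (Ss & l & Hl & Ls & HB & HG); split; auto.
      exists l; split; auto; split.
      * intros a n Ha Hn Hle; apply HD, HB; auto; lin.
      * intros p d H; pose proof H as (Hp & Hd & _).
        apply flag_le in Hp, Hd; apply HG; auto; lin.
    + intros (Ss & l & Ls & HB & HG); split; auto.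
      exists l; split; [now apply len_le |]; repeat split; auto.
      intros a _ n _ Ha Hn Hle; apply HD, HB; auto.
Qed.

(** Bit [i] belongs to the symbol [i / 2], and the rule looks for a separator up
    to the symbol after it; both bits of a symbol see the same separators. *)
Definition fires (s i : N) : Prop :=
  exists q, q < i + 1 + 1 + 1 /\ (q + q <= i + 1 + 1 /\ flag s q).

Definition step_bit (s i : N) : Prop :=
  (fires s i /\ bit s (i + 1 + 1)) \/ (~ fires s i /\ bit s i).

(** Two bits are lost, as each bit may come from two places further on. *)
Definition shorter (n l : N) : Prop := n = l + 1 + 1 \/ (n < 1 + 1 /\ l = 0).

Definition step (s t : N) : Prop :=
  string s /\ string t /\ exists n, n < s + 1 /\ exists l, l < t + 1 /\
    (len s n /\ len t l /\ shorter n l /\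
     forall i, i < l -> (bit t i <-> step_bit s i)).

Lemma system_map : exists f, (forall s t, app f s t <-> step s t) /\
  forall z, z ∈ f -> exists s t, z = pr s t.
Proof.
  destruct (Delta0_comprehension (fun z => exists s, s < z + 1 /\
    exists t, t < z + 1 /\ (z = pr s t /\ step s t))) as [f Hf].
  - unfold step, step_bit, fires, shorter, flag; delta0.
  - exists f; split.
    + intros s t; unfold app; rewrite Hf; split.
      * intros (s' & _ & t' & _ & E & H); now apply pr_inj in E as [<- <-].
      * intros H; exists s; split; [apply le_pr_l |].
        exists t; split; [apply le_pr_r | auto].
    + intros z Hz; apply Hf in Hz as (s & _ & t & _ & E & _); eauto.
Qed.

Lemma step_elim s t n l : step s t -> len s n -> len t l ->
  shorter n l /\ forall i, i < l -> (bit t i <-> step_bit s i).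
Proof.
  intros (_ & _ & n' & _ & l' & _ & Hn & Hl & H) Ln Ll.
  now rewrite (len_fun _ _ _ Ln Hn), (len_fun _ _ _ Ll Hl).
Qed.

Lemma step_lens s t : step s t -> exists n l, len s n /\ len t l.
Proof. intros (_ & _ & n & _ & l & _ & Hn & Hl & _); eauto. Qed.

Lemma step_exists s n l : string s -> len s n -> shorter n l ->
  exists t, step s t /\ len t l.
Proof.
  intros Ss Ls Hs.
  destruct (string_comprehension (step_bit s) l) as (t & St & Lt & Bt).
  { unfold step_bit, fires, flag; delta0. }
  exists t; split; auto; split; auto; split; auto.
  exists n; split; [now apply len_le |]; exists l; split; [now apply len_le |].
  auto.
Qed.

Lemma shorter_exists n : exists l, shorter n l.
Proof.
  destruct (num_lt_or_le n (1 + 1)) as [H|H]; [exists 0; right; auto |].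
  apply le_diff in H as [l ->]; exists l; left; ring.
Qed.

Lemma shorter_fun n l l' : shorter n l -> shorter n l' -> l = l'.
Proof. intros [H|[H H1]] [H'|[H' H1']]; lin. Qed.

Lemma step_fun s t t' : step s t -> step s t' -> t = t'.
Proof.
  intros H H'.
  destruct (step_lens _ _ H) as (n & l & Ln & Ll).
  destruct (step_lens _ _ H') as (n' & l' & Ln' & Ll').
  pose proof (len_fun _ _ _ Ln Ln'); subst n'; clear Ln'.
  destruct (step_elim _ _ _ _ H Ln Ll) as [Hs Hb].
  destruct (step_elim _ _ _ _ H' Ln Ll') as [Hs' Hb'].
  pose proof (shorter_fun _ _ _ Hs Hs'); subst l'.
  apply (string_ext t t' l); try apply H; try apply H'; auto.
  intros i Hi; now rewrite Hb, Hb'.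
Qed.

(** Although the rule is conditional, flags simply move one place to the left: a
    separator at [j + 1] triggers the rule at [j], and one at [j] would trigger
    it too, so it never stays. *)
Lemma step_flag s t j : step s t -> (flag t j <-> flag s (j + 1)).
Proof.
  intros H; destruct (step_lens _ _ H) as (n & l & Ln & Ll).
  destruct (step_elim _ _ _ _ H Ln Ll) as [Hs Hb].
  assert (E : j + 1 + (j + 1) = j + j + 1 + 1) by ring.
  unfold flag; rewrite E; split; intros F.
  - pose proof (bit_lt _ _ _ F Ll) as Hj.
    apply Hb in F as [[_ F]|[F G]]; auto.
    exfalso; apply F; exists j; repeat split; [lin | lin | exact G].
  - pose proof (bit_lt _ _ _ F Ln) as Hj.
    assert (Hl : j + j < l) by (destruct Hs as [Hs|[Hs _]]; lin).
    apply Hb; auto; left; split; auto; exists (j + 1); repeat split;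
      [lin | lin |]; unfold flag; now rewrite E.
Qed.

Lemma step_datum_after s t l j q : step s t -> len t l -> j + j + 1 < l ->
  flag s q -> q <= j + 1 -> (datum t j <-> datum s (j + 1)).
Proof.
  intros H Ll Hj Fq Hq; destruct (step_lens _ _ H) as (n & _ & Ln & _).
  destruct (step_elim _ _ _ _ H Ln Ll) as [_ Hb].
  unfold datum; rewrite (Hb _ Hj).
  replace (j + 1 + (j + 1) + 1) with (j + j + 1 + 1 + 1) by ring.
  assert (F : fires s (j + j + 1)) by (exists q; repeat split; auto; lin).
  unfold step_bit; tauto.
Qed.

Lemma step_datum_before s t l j : step s t -> len t l -> j + j + 1 < l ->
  (forall q, q <= j + 1 -> ~ flag s q) -> (datum t j <-> datum s j).
Proof.
  intros H Ll Hj Hq; destruct (step_lens _ _ H) as (n & _ & Ln & _).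
  destruct (step_elim _ _ _ _ H Ln Ll) as [_ Hb].
  unfold datum; rewrite (Hb _ Hj).
  assert (F : ~ fires s (j + j + 1)).
  { intros (q & _ & Hle & Fq); apply (Hq q); auto.
    destruct (num_lt_or_le q (j + 1 + 1)); auto; lin. }
  unfold step_bit; tauto.
Qed.

Lemma T_string r : r ∈ T -> string r.
Proof. apply T_tree. Qed.

Lemma T_prefix r s : string r -> s ∈ T -> prefix r s -> r ∈ T.
Proof. intros; now apply (proj2 T_tree r s). Qed.

Lemma T_level n : exists r, r ∈ T /\ len r n.
Proof.
  destruct (strings_bounded n) as [B HB].
  destruct (T_infinite B) as (s & Hs & HT).
  pose proof (T_string s HT) as Ss; destruct (string_len s Ss) as [l Ls].
  destruct (num_lt_or_le n l) as [Hl|Hl]; [| pose proof (HB s l Ss Ls Hl); lin].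
  destruct (string_comprehension (fun i => bit s i) n) as (r & Sr & Lr & Hr);
    [delta0 |].
  exists r; split; auto; apply (T_prefix r s); auto.
  apply (prefix_iff r s n l); auto; split; auto; lin.
Qed.

Lemma block_in_0 s a : block_in s a 0.
Proof.
  destruct (T_level 0) as (r & HT & Lr); exists r; repeat split; auto;
    try (now apply T_string); intros; lin.
Qed.

(** Gaps are preserved because flags are shifted together.  For the blocks,
    either a separator at or before the block's first symbol in [s] has shifted
    the data as well, or the block is the first one and its symbols have not
    moved. *)
Lemma admissible_step s t : admissible s -> step s t -> admissible t.
Proof.
  intros (Ss & n & Ln & HB & HG) H; pose proof H as (_ & St & _).
  destruct (step_lens _ _ H) as (n' & l & Ln' & Ll).
  pose proof (len_fun _ _ _ Ln Ln'); subst n'; clear Ln'.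
  destruct (step_elim _ _ _ _ H Ln Ll) as [Hs _].
  split; auto; exists l; split; auto; split.
  - intros a m Ha Hm Hle.
    destruct (num_case m) as [->|[m' Em]]; [apply block_in_0 |].
    assert (En : n = l + 1 + 1) by (destruct Hs as [Hs|[_ Hs]]; lin).
    assert (Hfl : forall i, i < m -> ~ flag s (a + 1 + i)).
    { intros i Hi F; apply (Hm i Hi), (step_flag s t _ H).
      now replace (a + i + 1) with (a + 1 + i) by ring. }
    assert (After : forall q, q <= a + 1 -> flag s q -> start s (a + 1) ->
              block_in t a m).
    { intros q Hq Fq Hst; apply (block_in_ext s t (a + 1) a).
      - intros i Hi; replace (a + 1 + i) with (a + i + 1) by ring; symmetry.
        apply (step_datum_after s t l (a + i) q); auto; lin.
      - apply HB; auto; lin. }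
    destruct Ha as [->|(c & Hc & -> & Fc)].
    + destruct (classic (flag s 0)) as [F|F].
      * apply (After 0); [lin | exact F |].
        right; exists 0; repeat split; auto; lin.
      * assert (Hcl : forall i, i < m + 1 -> ~ flag s i).
        { intros i Hi Fi; destruct (num_case i) as [->|[i' ->]]; auto.
          apply (Hfl i'); [lin |]; now replace (0 + 1 + i') with (i' + 1) by ring. }
        apply (block_in_ext s t 0 0).
        -- intros i Hi; replace (0 + i) with i by ring; symmetry.
           apply (step_datum_before s t l); auto; [lin |].
           intros q Hq; apply Hcl; lin.
        -- apply HB; [now left | | lin].
           intros i Hi; replace (0 + i) with i by ring; apply Hcl; lin.
    + apply (step_flag s t c H) in Fc.
      apply (After (c + 1)); [lin | exact Fc |].
      right; exists (c + 1); repeat split; auto; lin.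
  - intros p d (Fp & Fd & Hd & Hi) i Hlt F.
    apply (step_flag s t _ H) in Fp, Fd, F.
    apply (HG (p + 1) d) with i; auto.
    + repeat split; auto.
      * now replace (p + 1 + d) with (p + d + 1) by ring.
      * intros j Hj Hj0 G; apply (Hi j Hj Hj0), (step_flag s t _ H).
        now replace (p + j + 1) with (p + 1 + j) by ring.
    + now replace (p + 1 + d + (i + 1)) with (p + d + (i + 1) + 1) by ring.
Qed.

Lemma gap_ext (F G : N -> Prop) p d :
  (forall i, i <= p + d -> (F i <-> G i)) -> gap F p d -> gap G p d.
Proof.
  intros E (Hp & Hd & H0 & H); repeat split; auto; try (apply E; auto; lin).
  intros i Hi Hi0 Gi; apply (H i Hi Hi0), E; auto; lin.
Qed.

Lemma admissible_prefix s t : string s -> admissible t -> prefix s t -> admissible s.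
Proof.
  intros Ss (St & l & Lt & HB & HG) Hpre.
  destruct (string_len s Ss) as [k Ls].
  destruct (proj1 (prefix_iff s t k l Ss St Ls Lt) Hpre) as [Hkl Hbit].
  assert (Hst : forall i, flag s i -> flag t i).
  { intros i Fi; apply Hbit; auto; eapply bit_lt; eauto. }
  split; auto; exists k; split; auto; split.
  - intros a n Ha Hn Hle; apply (block_in_ext t s a a).
    + intros i Hi; symmetry; apply Hbit; lin.
    + apply HB; [| | lin].
      * destruct Ha as [->|(c & Hc & Ea & Fc)]; [now left | right].
        exists c; auto.
      * intros i Hi Fi; apply (Hn i Hi), Hbit; auto; lin.
  - intros p d Hgap i Hi Fi; pose proof Hgap as (_ & Fd & _).
    pose proof (flag_lt _ _ _ Fd Ls).
    apply (HG p d) with i; auto; revert Hgap; apply gap_ext.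
    intros j Hj; apply Hbit; lin.
Qed.

(** * A path of the system *)

(** Taking the least string of each length keeps the choice definable. *)
Definition chosen (r n : N) : Prop :=
  (r ∈ T /\ len r n) /\ forall s, s < r -> ~ (s ∈ T /\ len s n).

Lemma chosen_exists n : exists r, chosen r n.
Proof. apply least_number; [delta0 | apply T_level]. Qed.

Lemma chosen_unique r s n : chosen r n -> chosen s n -> r = s.
Proof.
  intros [Hr Mr] [Hs Ms]; destruct (num_lt_trichotomy r s) as [H|[H|H]]; auto;
    exfalso; [apply (Ms r H Hr) | apply (Mr s H Hs)].
Qed.

(** As for blocks, existence and uniqueness of the chosen string let its
    quantifier be read either way. *)
Lemma chosen_set : exists R, forall r n j, chosen r n -> (pr n j ∈ R <-> bit r j).
Proof.
  destruct (Delta1_comprehension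
    (fun z r => exists n, n < z + 1 /\ exists j, j < z + 1 /\
       (z = pr n j /\ chosen r n /\ bit r j))
    (fun z r => exists n, n < z + 1 /\ exists j, j < z + 1 /\
       (z = pr n j /\ (chosen r n -> bit r j)))) as [R HR].
  - unfold chosen; delta0.
  - unfold chosen; delta0.
  - intros z; split.
    + intros (r & n & Hn & j & Hj & E & Hr & Hb) s.
      exists n; split; auto; exists j; repeat split; auto.
      intros Hs; now rewrite (chosen_unique _ _ _ Hs Hr).
    + intros H; destruct (H 0) as (n & Hn & j & Hj & E & _).
      destruct (chosen_exists n) as [r Hr].
      exists r, n; split; auto; exists j; repeat split; auto; try apply Hr.
      destruct (H r) as (n' & _ & j' & _ & E' & Hb).
      rewrite E in E'; apply pr_inj in E' as [<- <-]; auto.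
  - exists R; intros r n j Hr; rewrite HR; split.
    + intros (s & n' & _ & j' & _ & E & Hs & Hb).
      apply pr_inj in E as [<- <-]; now rewrite (chosen_unique _ _ _ Hr Hs).
    + intros Hb; exists r, n; split; [apply le_pr_l |].
      exists j; split; [apply le_pr_r | auto].
Qed.

Lemma even_neq_odd x y : x + x <> y + y + 1.
Proof. intros E; destruct (num_lt_or_le y x); lin. Qed.

Lemma square_mono_inv u v : u * u < v * v -> u < v.
Proof.
  intros H; destruct (num_lt_trichotomy u v) as [L|[->|L]]; auto; [lin |].
  apply square_lt in L; lin.
Qed.

(** The separators sit at the squares, whose gaps increase, and the [u + u]
    symbols after the square of [u] spell the chosen string of that length. *)
Lemma admissible_path C : (forall s, s ∈ C <-> admissible s) -> exists X, path C X.
Proof.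
  intros HC; destruct chosen_set as [R HR].
  destruct (Delta0_comprehension (fun x =>
    (exists u, u < x + 1 /\ x = u * u + u * u) \/
    exists u, u < x + 1 /\ exists j, j < u + u /\
      (x = u * u + 1 + j + (u * u + 1 + j) + 1 /\ pr (u + u) j ∈ R))) as [X HX];
    [delta0 |].
  assert (Xeven : forall i, i + i ∈ X <-> exists u, i = u * u).
  { intros i; rewrite HX; split.
    - intros [(u & _ & E)|(u & _ & j & _ & E & _)].
      + exists u; lin.
      + now apply even_neq_odd in E.
    - intros [u ->]; left; exists u; split; auto.
      pose proof (le_square u); lin. }
  assert (Xodd : forall u i, i < u + u ->
            (u * u + 1 + i + (u * u + 1 + i) + 1 ∈ X <-> pr (u + u) i ∈ R)).
  { intros u i Hi; rewrite HX; split.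
    - intros [(v & _ & E)|(v & _ & j & Hj & E & H)].
      + symmetry in E; now apply even_neq_odd in E.
      + destruct (square_decomp u v i j) as [<- <-]; auto; lin.
    - intros H; right; exists u; split; [pose proof (le_square u); lin |].
      exists i; auto. }
  exists X; intros n; destruct (restriction_exists X n) as (s & Ss & Ls & Hs).
  exists s; split; [exact (conj Ss (conj Ls Hs)) |].
  assert (Hflag : forall i, flag s i <-> i + i < n /\ exists u, i = u * u).
  { intros i; rewrite <- Xeven; split.
    - intros F; pose proof (flag_lt _ _ _ F Ls) as Hi; split; auto.
      now apply Hs.
    - intros [Hi F]; now apply Hs. }
  assert (Next : forall u, (u + 1) * (u + 1) = u * u + (u + u + 1))
    by (intros; ring).
  apply HC; split; auto; exists n; split; auto; split.
  - intros a m Ha Hm Hle; destruct (num_case m) as [->|[m' Em]].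
    { apply block_in_0. }
    destruct Ha as [->|(c & _ & -> & Fc)].
    { exfalso; apply (Hm 0); [lin |]; apply Hflag; split; [lin |].
      exists 0; ring. }
    apply Hflag in Fc as [Hc [u ->]].
    assert (Hmu : m <= u + u).
    { destruct (num_lt_or_le (u + u) m) as [H|H]; auto; exfalso.
      (* the symbol after these would be the next square *)
      apply (Hm (u + u) H), Hflag; split; [lin |].
      exists (u + 1); ring. }
    destruct (chosen_exists (u + u)) as [r Hr]; pose proof Hr as [[HT Lr] _].
    destruct (string_comprehension (fun i => bit r i) m) as (t & St & Lt & Bt);
      [delta0 |].
    exists t; split.
    + split; auto; split; auto; intros i Hi; rewrite (Bt i Hi).
      rewrite <- (HR r _ i Hr), <- Xodd by lin; symmetry; apply Hs; lin.
    + apply (T_prefix t r); auto.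
      apply (prefix_iff t r m (u + u)); auto; now apply T_string.
  - intros p d (Fp & Fd & Hd & Hi) i Hlt F.
    apply Hflag in Fp as [Hp [u ->]], Fd as [Hdn [v Ev]], F as [Hn [w Ew]].
    assert (Huv : u < v) by (apply square_mono_inv; lin).
    assert (Hvw : v < w) by (apply square_mono_inv; lin).
    apply square_lt in Hvw.
    destruct (num_lt_or_le (u + 1) v) as [L|L].
    2: { assert (v = u + 1) as -> by (clear - M_RCA0 Huv L; lin).
         rewrite Next in *; clear - M_RCA0 Ev Ew Hvw Hlt; lin. }
    apply square_lt in L; rewrite Next in L.
    (* the square of [u + 1] would lie strictly inside the gap *)
    apply (Hi (u + u + 1)); [lin | lin |].
    apply Hflag; split; [lin |]; exists (u + 1); ring.
Qed.

(** * Recurrent points *)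

Definition state (F : N -> Prop) (a d : N) : Prop :=
  gap F a d /\ forall i, i < a -> ~ F i.

Lemma state_ext (F G : N -> Prop) a d :
  (forall i, i <= a + d -> (F i <-> G i)) -> state F a d -> state G a d.
Proof.
  intros E [Hg H]; split; [now apply (gap_ext F G) |].
  intros i Hi Gi; apply (H i Hi), E; auto; lin.
Qed.

Lemma state_unique F a d a' d' : state F a d -> state F a' d' -> a = a' /\ d = d'.
Proof.
  intros [(Fa & Fd & H0 & H) Hb] [(Fa' & Fd' & H0' & H') Hb'].
  destruct (num_lt_trichotomy a a') as [L|[<-|L]].
  - destruct (Hb' a L Fa).
  - split; auto; destruct (num_lt_trichotomy d d') as [L|[L|L]]; auto.
    + destruct (H' d L H0 Fd).
    + destruct (H d' L H0' Fd').
  - destruct (Hb a' L Fa').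
Qed.

(** Read backwards, the map moves both separators one place to the right; if a
    separator stood at the front of [s] it was deleted, and then the gap that it
    opened is smaller than the one that [t] begins with. *)
Lemma state_step s t a d : admissible s -> step s t -> state (flag t) a d ->
  state (flag s) (a + 1) d \/ exists d', d' < d /\ state (flag s) 0 d'.
Proof.
  intros (_ & n & _ & _ & HG) H [(Fa & Fd & H0 & Hi) Hb].
  apply (step_flag s t _ H) in Fa, Fd.
  assert (Hb' : forall i, i < a -> ~ flag s (i + 1)).
  { intros i Hlt F; apply (Hb i Hlt), (step_flag s t _ H), F. }
  destruct (classic (flag s 0)) as [F0|F0].
  - assert (Hgap : gap (flag s) 0 (a + 1)).
    { repeat split; auto; [now replace (0 + (a + 1)) with (a + 1) by ring | lin |].
      intros i Hlt Hpos F; destruct (num_case i) as [->|[j ->]]; [lin |].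
      apply (Hb' j); [lin |]; now replace (0 + (j + 1)) with (j + 1) in F by ring. }
    right; exists (a + 1); split; [| split; [exact Hgap | intros; lin]].
    destruct (num_lt_or_le (a + 1) d) as [L|L]; auto; exfalso.
    destruct (num_case d) as [->|[i ->]]; [lin |].
    apply (HG 0 (a + 1) Hgap i); [lin |].
    now replace (0 + (a + 1) + (i + 1)) with (a + (i + 1) + 1) by ring.
  - left; split.
    + repeat split; auto; [now replace (a + 1 + d) with (a + d + 1) by ring |].
      intros i Hlt Hpos F; apply (Hi i Hlt Hpos), (step_flag s t _ H).
      now replace (a + i + 1) with (a + 1 + i) by ring.
    + intros i Hlt F; destruct (num_case i) as [->|[j ->]]; auto.
      apply (Hb' j); auto; lin.
Qed.

(** Going back from [t], the gap never exceeds [d], and as long as it equals [d]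
    the first separator lies farther right at every step.  So [s] can be in the
    state of [t] only if there was no step. *)
Lemma iter_not_recurrent C f k s t a d :
  (forall s, s ∈ C <-> admissible s) -> (forall s t, app f s t <-> step s t) ->
  s ∈ C -> iter f k s t -> state (flag s) a d -> state (flag t) a d -> k = 0.
Proof.
  intros HC Hf Hs (c & _ & _ & E0 & Ek & Hstep) Ss St.
  assert (Fwd : forall j, j <= k -> exists u, u < c + 1 /\ (entry c j u /\ u ∈ C)).
  { intros j; induct j.
    - intros _; exists s; split; auto; now apply entry_le in E0.
    - intros j IH Hj; destruct (IH ltac:(lin)) as (u & _ & Hu & Cu).
      destruct (Hstep j) as (u' & v & Hu' & Hv & Huv); [lin |].
      rewrite <- (entry_fun _ _ _ _ Hu Hu') in Huv.
      exists v; split; [now apply entry_le in Hv |]; split; auto.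
      apply HC, (admissible_step u); [now apply HC | now apply Hf]. }
  assert (Bwd : forall j, j <= k -> exists i, i < k + 1 /\ (i + j = k /\
    exists u, u < c + 1 /\ (entry c i u /\ exists d', d' < d + 1 /\
      exists a', a' < a + j + 1 /\ (state (flag u) a' d' /\
        (d' < d \/ (d' = d /\ a' = a + j)))))).
  { intros j; unfold state, gap, flag; induct j; fold (flag t).
    - intros _; exists k; split; [lin |]; split; [ring |].
      exists t; split; [now apply entry_le in Ek |]; split; auto.
      exists d; split; [lin |]; exists a; split; [lin |]; split; [exact St |].
      right; split; auto; ring.
    - intros j IH Hj; destruct (IH ltac:(lin)) as
        (i & Hi & Eij & u & _ & Hu & d' & Hd' & a' & Ha' & Su & Hda).
      destruct (num_case i) as [->|[i' ->]]; [lin |].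
      destruct (Hstep i') as (v & u' & Hv & Hu' & Hvu); [lin |].
      rewrite <- (entry_fun _ _ _ _ Hu Hu') in Hvu.
      destruct (Fwd i') as (v' & _ & Hv' & Cv); [lin |].
      rewrite <- (entry_fun _ _ _ _ Hv Hv') in Cv.
      exists i'; split; [lin |]; split; [lin |].
      exists v; split; [now apply entry_le in Hv |]; split; auto.
      destruct (state_step v u a' d') as [Sv|(d'' & Hd'' & Sv)]; auto.
      + now apply HC.
      + now apply Hf.
      + exists d'; split; auto; exists (a' + 1); split; [lin |].
        split; [exact Sv |]; destruct Hda as [L|[Ed Ea]]; [now left | right].
        split; auto; rewrite Ea; ring.
      + exists d''; split; [lin |]; exists 0; split; [lin |].
        split; [exact Sv | left; lin]. }
  destruct (Bwd k) as (i & _ & Ei & u & _ & Hu & d' & _ & a' & _ & Su & Hda); [lin |].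
  assert (i = 0) as -> by lin.
  rewrite (entry_fun _ _ _ _ Hu E0) in Su.
  destruct (state_unique _ _ _ _ _ Ss Su) as [<- <-].
  destruct Hda as [L|[_ Ea]]; lin.
Qed.

(** A last block that is never closed spells longer and longer members of [T],
    each extending the previous. *)
Lemma path_of_tail C X a :
  (forall s, s ∈ C <-> admissible s) -> path C X ->
  (a = 0 \/ exists c, a = c + 1 /\ c + c ∈ X) ->
  (forall i, ~ a + i + (a + i) ∈ X) -> exists P, path T P.
Proof.
  intros HC HX Ha Hi.
  destruct (Delta0_comprehension (fun i => a + i + (a + i) + 1 ∈ X)) as [P HP];
    [delta0 |].
  exists P; intros n.
  destruct (HX (a + n + (a + n))) as (s & (Ss & Ls & Hs) & HCs).
  apply HC in HCs as (_ & l & Ll & HB & _).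
  pose proof (len_fun _ _ _ Ll Ls); subst l.
  destruct (HB a n) as (r & (Sr & Lr & Br) & HT); [| | lin |].
  - destruct Ha as [->|(c & -> & Xc)]; [now left | right].
    exists c; split; [lin |]; split; auto; apply Hs; auto; lin.
  - intros i Hlt F; apply (Hi i), Hs; auto; lin.
  - exists r; split; auto; split; auto; split; auto.
    intros i Hlt; rewrite HP, <- (Hs (a + i + (a + i) + 1)) by lin.
    apply (Br i Hlt).
Qed.

Lemma recurrent_gives_path C f X :
  (forall s, s ∈ C <-> admissible s) -> (forall s t, app f s t <-> step s t) ->
  recurrent_point C f X -> exists P, path T P.
Proof.
  intros HC Hf [HX Hrec].
  destruct (classic (exists p, p + p ∈ X)) as [Hp|Hp].
  2: { apply (path_of_tail C X 0); auto; intros i Hi; apply Hp; eauto. }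
  destruct (least_number (fun p => p + p ∈ X)) as (p & Xp & Mp); [delta0 | auto |].
  destruct (classic (exists d, 0 < d /\ p + d + (p + d) ∈ X)) as [Hd|Hd].
  2: { apply (path_of_tail C X (p + 1)); auto; [right; exists p; auto |].
       intros i Hi; apply Hd; exists (1 + i); split; [lin |].
       now replace (p + (1 + i)) with (p + 1 + i) by ring. }
  destruct (least_number (fun d => 0 < d /\ p + d + (p + d) ∈ X))
    as (d & [Hd0 Xd] & Md); [delta0 | auto |].
  set (F := fun i => i + i ∈ X).
  assert (SX : state F p d).
  { repeat split; auto; intros i Hi Hi0 Fi; apply (Md i Hi); auto. }
  (* just long enough to show both separators *)
  set (c := p + d + (p + d) + 1).
  destruct (Hrec 1 c) as (k & Y & HY & r & Xr & Yr).
  destruct (HY c) as (r' & Yr' & m & Hm).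
  rewrite (restriction_unique _ _ _ _ Yr' Yr) in Hm; clear r' Yr'.
  destruct (Hm (m + c)) as (s & t & Xs & Hst & Hpre); [lin |].
  destruct (HX (m + c)) as (s' & Xs' & Cs).
  rewrite (restriction_unique _ _ _ _ Xs' Xs) in Cs; clear s' Xs'.
  destruct Xs as (Ss & Ls & Hs), Xr as (Sr & Lr & Hr).
  assert (E : 1 + k = 0); [| exfalso; lin].
  apply (iter_not_recurrent C f (1 + k) s t p d); auto.
  - revert SX; apply state_ext; intros i Hi; symmetry; apply Hs; unfold c; lin.
  - destruct Hpre as (n & _ & l & _ & Ln & Lt & Hnl & Hv).
    pose proof (len_fun _ _ _ Ln Lr); subst n.
    apply (agree_entries c r t c l) in Hv; auto; [| lin].
    revert SX; apply state_ext; intros i Hi.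
    assert (Hic : i + i < c) by (unfold c; lin).
    unfold F; rewrite <- (Hr _ Hic); apply (Hv _ Hic).
Qed.

Lemma system_of_tree C f :
  (forall s, s ∈ C <-> admissible s) -> (forall s t, app f s t <-> step s t) ->
  (forall z, z ∈ f -> exists s t, z = pr s t) -> system C f.
Proof.
  intros HC Hf Hz; split; [| split; [| split]].
  - split.
    + intros s Hs; now apply HC in Hs as [Ss _].
    + intros s t (Ss & Ct & Hst); apply HC; apply HC in Ct.
      now apply (admissible_prefix s t).
  - split; [| split; [| split]].
    + split.
      * intros z Hzf; destruct (Hz z Hzf) as (s & t & ->); exists s, t.
        apply Hf in Hzf; split; auto; split; apply Hzf.
      * intros s Ss; destruct (string_len s Ss) as [n Ls].
        destruct (shorter_exists n) as [l Hl].
        destruct (step_exists s n l Ss Ls Hl) as (t & Ht & _).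
        exists t; split; [now apply Hf |]; intros u Hu; apply Hf in Hu.
        now apply (step_fun s).
    + intros s t s' t' (Ss & St & Hst & Hs & Ht); apply Hf in Hs, Ht.
      destruct (step_lens _ _ Hs) as (n & l & Ln & Ll).
      destruct (step_lens _ _ Ht) as (n' & l' & Ln' & Ll').
      destruct (step_elim _ _ _ _ Hs Ln Ll) as [Hsh Hb].
      destruct (step_elim _ _ _ _ Ht Ln' Ll') as [Hsh' Hb'].
      destruct (proj1 (prefix_iff s t n n' Ss St Ln Ln') Hst) as [Hnn Hbit].
      assert (Hll : l <= l')
        by (destruct Hsh as [?|[? ?]], Hsh' as [?|[? ?]]; lin).
      apply (prefix_iff s' t' l l'); try apply Hs; try apply Ht; auto.
      split; auto; intros i Hi; rewrite Hb, Hb' by lin.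
      assert (En : n = l + 1 + 1) by (destruct Hsh as [?|[_ ?]]; lin).
      assert (HF : fires s i <-> fires t i).
      { split; intros (q & Hq & Hqi & Fq); exists q; repeat split; auto;
          apply Hbit; auto; lin. }
      unfold step_bit; rewrite HF, !Hbit by lin; reflexivity.
    + intros l; exists (l + 1 + 1); intros s (Ss & Ls).
      destruct (step_exists s (l + 1 + 1) l Ss Ls) as (t & Ht & Lt); [now left |].
      exists t, l; split; [now apply Hf |]; split; auto; lin.
    + intros s t m k (Ss & Ls & Hm & Hst & Lt); apply Hf in Hst.
      destruct (step_elim _ _ _ _ Hst Ls Lt) as [[H|[H ->]] _]; [lin |].
      destruct (num_case m) as [->|[m' ->]]; [tauto | lin].
  - now apply admissible_path.
  - intros s t (Cs & Hst); apply HC; apply HC in Cs; apply Hf in Hst.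
    now apply (admissible_step s).
Qed.

End System.

Theorem recurrence_gives_weak_konig :
  (forall C f, system C f -> exists X, recurrent_point C f X) ->
  forall T, tree T /\ infinite T -> exists X, path T X.
Proof.
  intros HRP T [HT HI].
  destruct (system_tree T) as [C HC]; destruct system_map as (f & Hf & Hz).
  destruct (HRP C f) as [X HX]; [now apply (system_of_tree T) |].
  now apply (recurrent_gives_path T HT HI C f X).
Qed.

End Model.

Theorem theorem6 : proves (extend RCA0 RP) WKL.
Proof.
  apply completeness; [exact RCA0_RP_subst |].
  intros M HM e r.
  apply sat_WKL, recurrence_gives_weak_konig.
  - intros q Hq; apply HM; now left.
  - exact (proj1 (sat_RP M e r) (HM RP (or_intror eq_refl) e r)).
Qed.
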